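(* Let $n\ge1$ and $\alpha\in(0,1)$. If $f\in BV^\alpha(\mathbb R^n)$, then there exists a sequence $(f_k)_{k\in\mathbb N}\subset BV^\alpha(\mathbb R^n)\cap C^\infty(\mathbb R^n)$ such that, as $k\to+\infty$, (i) $f_k\to f$ in $L^1(\mathbb R^n)$; (ii) $|D^\alpha f_k|(\mathbb R^n)\to|D^\alpha f|(\mathbb R^n)$.
   Context: For $\alpha\in(0,1)$ let $\mu_{n,\alpha}:=2^\alpha\pi^{-n/2}\,\Gamma\big(\tfrac{n+\alpha+1}{2}\big)/\Gamma\big(\tfrac{1-\alpha}{2}\big)$. For $\varphi\in C^\infty_c(\mathbb R^n;\mathbb R^n)$ the fractional $\alpha$-divergence is $$\mathrm{div}^\alpha\varphi(x):=\mu_{n,\alpha}\int_{\mathbb R^n}\frac{(y-x)\cdot(\varphi(y)-\varphi(x))}{|y-x|^{n+\alpha+1}}\,dy,$$ which is a function in $L^1(\mathbb R^n)\cap L^\infty(\mathbb R^n)$. For $f\in L^1(\mathbb R^n)$ the fractional variation is $$|D^\alpha f|(\mathbb R^n):=\sup\Big\{\int_{\mathbb R^n}f\,\mathrm{div}^\alpha\varphi\,dx:\ \varphi\in C^\infty_c(\mathbb R^n;\mathbb R^n),\ \|\varphi\|_{L^\infty(\mathbb R^n;\mathbb R^n)}\le1\Big\}.$$ The space $BV^\alpha(\mathbb R^n)$ consists of all $f\in L^1(\mathbb R^n)$ with $|D^\alpha f|(\mathbb R^n)<+\infty$. *)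

(* Defs.v *)
From HB Require Import structures.
From mathcomp Require Import all_boot all_order all_algebra.
From mathcomp Require Import all_classical all_reals all_analysis.

Set Implicit Arguments.
Unset Strict Implicit.
Unset Printing Implicit Defensive.
Import Order.TTheory GRing.Theory Num.Theory.
Import numFieldNormedType.Exports.

Local Open Scope classical_set_scope.
Local Open Scope ring_scope.

(* R^n is 'rV[R]_n.  The library puts the sup norm `|x| on it (hence the usual
   topology); the Euclidean norm of the statement is [enorm] below. *)

Definition measure_rV_display : measure_display.
Proof. exact. Qed.

(* The sigma-algebra of 'rV[R]_n is the n-fold product of the Borel
   sigma-algebra of R, i.e. the Borel sigma-algebra of R^n; it is generated by
   the coordinate maps, as the library does for n.-tuple. *)
Section measurable_rV.
Context {R : realType} (n : nat).

Definition coord_rV (i : 'I_n) (x : 'rV[R]_n) : measurableTypeR R := x ord0 i.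

Let rV_set0 : g_sigma_preimage coord_rV set0.
Proof. exact: sigma_algebra0. Qed.

Let rV_setC A : g_sigma_preimage coord_rV A ->
  g_sigma_preimage coord_rV (~` A).
Proof. exact: sigma_algebraC. Qed.

Let rV_bigcup (F : (set 'rV[R]_n)^nat) :
  (forall i, g_sigma_preimage coord_rV (F i)) ->
  g_sigma_preimage coord_rV (\bigcup_i (F i)).
Proof. exact: sigma_algebra_bigcup. Qed.

HB.instance Definition _ := @isMeasurable.Build measure_rV_display
  'rV[R]_n (g_sigma_preimage coord_rV) rV_set0 rV_setC rV_bigcup.

Lemma measurable_coord_rV i : measurable_fun [set: 'rV[R]_n] (coord_rV i).
Proof.
move=> _ Y mY; rewrite setTI; apply: sub_sigma_algebra => /=.
rewrite -bigcup_seq/=; exists i => /=; first by rewrite mem_index_enum.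
by exists Y => //; rewrite setTI.
Qed.

Lemma measurable_fun_rV d (T : measurableType d) (f : T -> 'rV[R]_n) :
  (forall i, measurable_fun [set: T] (coord_rV i \o f)) ->
  measurable_fun [set: T] f.
Proof.
move=> mf.
have : g_sigma_preimage (fun i => coord_rV i \o f) `<=` measurable.
  apply: smallest_sub; first exact: sigma_algebra_measurable.
  rewrite -bigcup_seq/=; apply: bigcup_sub => i _.
  by move=> A [B mB <-]; exact: mf.
rewrite g_sigma_preimage_comp => H _ A mA; apply: H; by exists A.
Qed.

End measurable_rV.

Section cons_rV.
Context {R : realType} (n : nat).

Definition cons_rV (p : measurableTypeR R * 'rV[R]_n) : 'rV[R]_n.+1 :=
  \row_i (if unlift ord0 i is Some j then p.2 ord0 j else p.1).

Definition uncons_rV (x : 'rV[R]_n.+1) : measurableTypeR R * 'rV[R]_n :=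
  (x ord0 ord0, \row_j x ord0 (lift ord0 j)).

Lemma cons_rVK : cancel cons_rV uncons_rV.
Proof.
move=> [t x]; rewrite /uncons_rV mxE unlift_none/=; congr pair.
by apply/rowP => j; rewrite !mxE liftK.
Qed.

Lemma uncons_rVK : cancel uncons_rV cons_rV.
Proof.
move=> x; apply/rowP => i; rewrite mxE.
by case: unliftP => [j ->|->] //=; rewrite mxE.
Qed.

Lemma measurable_cons_rV : measurable_fun setT cons_rV.
Proof.
apply: measurable_fun_rV => i; case: (unliftP ord0 i) => [j ->|->].
- rewrite (_ : _ \o _ = coord_rV j \o snd).
    by apply: measurableT_comp; [exact: measurable_coord_rV|].
  by apply/funext => p /=; rewrite /coord_rV mxE liftK.
- rewrite (_ : _ \o _ = fst) //.
  by apply/funext => p /=; rewrite /coord_rV mxE unlift_none.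
Qed.

Lemma measurable_uncons_rV : measurable_fun setT uncons_rV.
Proof.
apply/measurable_fun_pair => /=; first exact: (measurable_coord_rV ord0).
apply: measurable_fun_rV => i.
rewrite (_ : _ \o _ = coord_rV (lift ord0 i)); first exact: measurable_coord_rV.
by apply/funext => p /=; rewrite /coord_rV mxE.
Qed.

End cons_rV.

Section lebesgue_cons.
Local Open Scope ereal_scope.
Context {R : realType} (n : nat).
Variable m : {sigma_finite_measure set 'rV[R]_n -> \bar R}.

Definition lebesgue_cons : set 'rV[R]_n.+1 -> \bar R :=
  pushforward (lebesgue_measure \x m) (@cons_rV R n).

Let mcons (A : set 'rV[R]_n.+1) : measurable A ->
  measurable (@cons_rV R n @^-1` A).
Proof.
by move=> mA; rewrite -[X in measurable X]setTI; exact: measurable_cons_rV.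
Qed.

Let lebesgue_cons0 : lebesgue_cons set0 = 0.
Proof. by rewrite /lebesgue_cons /pushforward preimage_set0 measure0. Qed.

Let lebesgue_cons_ge0 A : 0 <= lebesgue_cons A.
Proof. by rewrite /lebesgue_cons /pushforward measure_ge0. Qed.

Let lebesgue_cons_sigma_additive : semi_sigma_additive lebesgue_cons.
Proof.
move=> F mF tF mUF; rewrite /lebesgue_cons /pushforward preimage_bigcup.
apply: measure_semi_sigma_additive.
- by move=> k; exact: mcons.
- apply/trivIsetP => /= i j _ _ ij; rewrite -preimage_setI.
  by move/trivIsetP : tF => /(_ _ _ _ _ ij) ->//; rewrite preimage_set0.
- by rewrite -preimage_bigcup; exact: mcons.
Qed.

HB.instance Definition _ := isMeasure.Build _ _ _ lebesgue_cons
  lebesgue_cons0 lebesgue_cons_ge0 lebesgue_cons_sigma_additive.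

Lemma lebesgue_consE (A : set (measurableTypeR R)) (B : set 'rV[R]_n) :
  measurable A -> measurable B ->
  lebesgue_cons (@uncons_rV R n @^-1` (A `*` B)) = lebesgue_measure A * m B.
Proof.
move=> mA mB; rewrite /lebesgue_cons /pushforward -comp_preimage.
rewrite (_ : _ \o _ = id); last by apply/funext => p /=; rewrite cons_rVK.
by rewrite preimage_id product_measure1E.
Qed.

Let lebesgue_cons_sigma_finite : sigma_finite setT lebesgue_cons.
Proof.
have /sigma_finiteP[F [TF ndF Foo]] :=
  sigma_finiteT (@lebesgue_measure R).
have /sigma_finiteP[G [TG ndG Goo]] := sigma_finiteT m.
exists (fun k => @uncons_rV R n @^-1` (F k `*` G k)).
  apply/esym; rewrite -subTset => x _.
  have [k _ Fk] : (\bigcup_k F k) (uncons_rV x).1 by rewrite -TF.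
  have [l _ Gl] : (\bigcup_k G k) (uncons_rV x).2 by rewrite -TG.
  exists (maxn k l) => //; split.
  - by move: Fk; exact/subsetPset/ndF/leq_maxl.
  - by move: Gl; exact/subsetPset/ndG/leq_maxr.
move=> k; have [mF oF] := Foo k; have [mG oG] := Goo k; split.
  rewrite -[X in measurable X]setTI; apply: measurable_uncons_rV => //.
  exact: measurableX.
by rewrite lebesgue_consE// lte_mul_pinfty// ge0_fin_numE.
Qed.

HB.instance Definition _ := @Measure_isSigmaFinite.Build _ _ _
  lebesgue_cons lebesgue_cons_sigma_finite.

End lebesgue_cons.

(* Lebesgue measure on R^n, as the n-fold product of Lebesgue measure on R:
   lebesgue_rV n.+1 (A * B) = lebesgue_measure A * lebesgue_rV n B by
   [lebesgue_consE], and [lebesgue_rV_box] gives the volume of boxes. *)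
Fixpoint lebesgue_rV {R : realType} (n : nat) :
    {sigma_finite_measure set 'rV[R]_n -> \bar R} :=
  match n with
  | 0 => dirac (0 : 'rV[R]_0)
  | n'.+1 => lebesgue_cons (lebesgue_rV n')
  end.

Lemma lebesgue_rV_box {R : realType} (n : nat) (A : 'I_n -> set R) :
  (forall i, measurable (A i : set (measurableTypeR R))) ->
  lebesgue_rV n [set x | forall i, A i (x ord0 i)] =
  (\prod_(i < n) lebesgue_measure (A i))%E.
Proof.
elim: n A => [|n IHn] A mA /=.
  rewrite big_ord0 diracE mem_set// => i; by case: i.
have mB k (B : 'I_k -> set R) :
    (forall i, measurable (B i : set (measurableTypeR R))) ->
    measurable [set x : 'rV[R]_k | forall i, B i (x ord0 i)].
  move=> mB; rewrite (_ : [set _ | _] =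
      \bigcap_(i in [set: 'I_k]) (@coord_rV R k i @^-1` B i)); last first.
    by apply/seteqP; split => x /= Bx i; [move=> _; exact: Bx|exact: Bx].
  apply: fin_bigcap_measurable => [|i _]; first exact: finite_finset.
  by rewrite -[X in measurable X]setTI; exact: measurable_coord_rV.
rewrite big_ord_recl -(IHn (fun i => A (lift ord0 i)) (fun i => mA _)).
rewrite -lebesgue_consE; [|exact: mA|exact: (mB n _ (fun i => mA (lift ord0 i)))].
congr (lebesgue_cons _ _); apply/seteqP; split => x /=.
- by move=> Ax; split => [|i] /=; rewrite ?mxE; exact: Ax.
- move=> [A0 A1] i; case: (unliftP ord0 i) => [j ->|->] //.
  by have := A1 j; rewrite mxE.
Qed.

Section euclidean.
Context {R : realType} (n : nat).
Implicit Types x y : 'rV[R]_n.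

Definition edot x y : R := \sum_(i < n) x ord0 i * y ord0 i.
Definition enorm x : R := Num.sqrt (edot x x).

End euclidean.

Section smooth.
Context {R : realType} (n : nat) (V : normedModType R).
Implicit Types f : 'rV[R]_n -> V.

Definition evec (i : 'I_n) : 'rV[R]_n := delta_mx ord0 i.

Fixpoint iter_partial (s : seq 'I_n) f : 'rV[R]_n -> V :=
  if s is i :: s' then iter_partial s' ('D_(evec i) f) else f.

(* C^infinity: all iterated partial derivatives exist and are continuous.
   ('D is total, so existence has to be required separately.) *)
Definition smooth f : Prop := forall s : seq 'I_n,
  continuous (iter_partial s f) /\
  forall i x, derivable (iter_partial s f) x (evec i).

Definition compactly_supported f : Prop :=
  compact (closure [set x | f x != 0]).

End smooth.

Section fractional_variation.
Context {R : realType} (n : nat) (alpha : R).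
Local Notation leb := (@lebesgue_rV R n).

Definition Gamma (s : R) : R :=
  \int[@lebesgue_measure R]_(t in `]0, +oo[) (t `^ (s - 1) * expR (- t)).

Definition mu_const : R :=
  2 `^ alpha * pi `^ (- (n%:R / 2)) *
  Gamma ((n%:R + alpha + 1) / 2) / Gamma ((1 - alpha) / 2).

(* At y = x the integrand is 0 / 0 = 0; this is a Lebesgue-null set. *)
Definition fdiv (phi : 'rV[R]_n -> 'rV[R]_n) (x : 'rV[R]_n) : R :=
  mu_const * \int[leb]_y
    (edot (y - x) (phi y - phi x) / enorm (y - x) `^ (n%:R + alpha + 1)).

Definition test_field (phi : 'rV[R]_n -> 'rV[R]_n) : Prop :=
  [/\ smooth phi, compactly_supported phi &
      ('N[leb]_+oo[EFin \o (enorm (n:=n) \o phi)] <= 1)%E].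

Definition fvar (f : 'rV[R]_n -> R) : \bar R :=
  ereal_sup [set (\int[leb]_x (f x * fdiv phi x)%:E)%E | phi in test_field].

(* Elements of L^1 are represented by Borel functions; every Lebesgue class
   has such a representative. *)
Definition BV : set ('rV[R]_n -> R) :=
  [set f | leb.-integrable [set: 'rV[R]_n] (EFin \o f) /\ (fvar f < +oo)%E].

End fractional_variation.

(* Main.v *)
(* Take f_k = f * rho_k for even mollifiers rho_k.  Convolution with rho_k commutes with the
   fractional divergence and is self-adjoint, so for a test field phi,
   int f_k div^alpha phi = int f div^alpha (phi * rho_k), and phi * rho_k is again a test field:
   |D^alpha f_k| <= |D^alpha f|.  Conversely div^alpha phi is bounded, hence
   f |-> int f div^alpha phi is L^1-continuous and |D^alpha .| is lower semicontinuous.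
   Convergence in L^1 is the continuity of translations in L^1. *)
Require Import Defs.
From mathcomp Require Import all_boot all_order all_algebra.
From mathcomp Require Import all_classical all_reals all_analysis.
From mathcomp Require Import measurable_realfun ess_sup_inf lra.
Import Order.TTheory GRing.Theory Num.Theory.
Import numFieldNormedType.Exports.
Local Open Scope classical_set_scope.
Local Open Scope ring_scope.
Set Implicit Arguments.
Unset Strict Implicit.
Unset Printing Implicit Defensive.

(** * Measurability and the Euclidean norm on R^n *)

Section euclidean_space.
Context {R : realType} {n : nat}.
Implicit Types x y : 'rV[R]_n.

(** The integral defining div^alpha phi is singular at y = x. For a bounded Lipschitz phi its
    integrand at y = x + h is at most C min(|h|, 1) / |h|^(n + alpha), a majorant that does not
    depend on x and is integrable because 0 < alpha < 1. This one bound gives both the boundedness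
    of div^alpha phi and the Fubini exchange behind the commutation with convolution. Continuity of
    translations in L^1 is obtained without continuous approximants: it is checked on indicators of
    open sets, carried to measurable sets by a pi-lambda argument, then to simple functions and
    their L^1 limits. Smoothness of f * rho_k rests on an explicit family of bumps closed under
    differentiation: each derivative of the convolution is again the convolution of f with a member
    of the family. Estimates are made in the sup norm [|x|]; the Euclidean norm enters through
    [|x| <= enorm x] and Cauchy-Schwarz. *)

Lemma ler_coord_norm x i : `|x ord0 i| <= `|x|.
Proof.
rewrite [leRHS]/Num.norm /= mx_normrE; apply/bigmax_geP; right => /=.
by exists (ord0, i).
Qed.

Lemma normr_rV_le x (c : R) : 0 <= c -> (forall i, `|x ord0 i| <= c) -> `|x| <= c.
Proof.
move=> c0 xc; rewrite [leLHS]/Num.norm /= mx_normrE; apply/bigmax_leP; split => //.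
by move=> [i j] _ /=; rewrite ord1.
Qed.

Lemma normr_rV_lt x (c : R) : 0 < c -> (forall i, `|x ord0 i| < c) -> `|x| < c.
Proof.
move=> c0 xc; rewrite [ltLHS]/Num.norm /= mx_normrE; apply/bigmax_ltP; split => //.
by move=> [i j] _ /=; rewrite ord1.
Qed.

End euclidean_space.

Section measurable_rV_theory.
Context {R : realType} {n : nat}.
Implicit Types x y : 'rV[R]_n.

Lemma measurable_box (A : 'I_n -> set R) :
    (forall i, measurable (A i : set (measurableTypeR R))) ->
  measurable [set x : 'rV[R]_n | forall i, A i (x ord0 i)].
Proof.
move=> mA; rewrite (_ : [set _ | _] =
    \bigcap_(i in [set: 'I_n]) (@coord_rV R n i @^-1` A i)); last first.
  by apply/seteqP; split => x /= Ax i; [move=> _; exact: Ax|exact: Ax].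
apply: fin_bigcap_measurable => [|i _]; first exact: finite_finset.
by rewrite -[X in measurable X]setTI; exact: measurable_coord_rV.
Qed.

Local Definition rational_box (p : 'rV[rat]_n * nat) : set 'rV[R]_n :=
  [set x | forall i, ball (ratr (p.1 ord0 i) : R) p.2.+1%:R^-1 (x ord0 i)].

(** The sigma-algebra is generated by coordinates, not by open sets, so second countability is
    needed: an open set is the union of the rational cubes that it contains, and these are countably
    many. *)
Lemma open_measurable_rV (U : set 'rV[R]_n) : open U -> measurable U.
Proof.
move=> oU.
rewrite (_ : U = \bigcup_(p in [set p | rational_box p `<=` U]) rational_box p).
  rewrite bigcup_mkcond; apply: countable_bigcupT_measurable.
    exact: countableP.
  by move=> p; case: ifP => // _; apply: (@measurable_box (fun i => ball _ _)) => i;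
    exact: measurable_ball.
apply/seteqP; split => [x Ux|x [p pU px]]; last exact: pU.
have /nbhs_ballP[e /= e0 xeU] : nbhs x U by exact: open_nbhs_nbhs.
(* A cube of radius below [e / 2] that contains [x] lies in the ball of radius [e] around [x]. *)
have [k ke] : exists k, k.+1%:R^-1 < e / 2 :> R.
  have e20 : 0 < e / 2 by rewrite divr_gt0.
  have [N _ H] := near_infty_natSinv_lt (PosNum e20).
  by exists N; exact: (H N (leqnn N)).
have qx i : {q : rat | `|x ord0 i - ratr q| < k.+1%:R^-1}.
  apply/cid; have : x ord0 i - k.+1%:R^-1 < x ord0 i + k.+1%:R^-1.
    by rewrite ltrD2l gt0_cp // invr_gt0.
  move=> /rat_in_itvoo[q]; rewrite in_itv/= => /andP[q1 q2].
  by exists q; rewrite distrC ltr_distl q1 q2.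
exists ((\row_i sval (qx i), k) : 'rV[rat]_n * nat) => /=; last first.
  by move=> i; rewrite /ball/= mxE distrC; exact: (svalP (qx i)).
move=> y yk; apply: xeU; rewrite mx_norm_ball /ball_ /=.
apply: normr_rV_lt => // i; rewrite !mxE.
have := yk i; rewrite /ball/= mxE => yi.
rewrite (le_lt_trans (ler_distD (ratr (sval (qx i))) _ _))//.
by rewrite [e]splitr ltrD// (lt_trans _ ke)//; exact: (svalP (qx i)).
Qed.

Lemma continuous_measurable_rV (f : 'rV[R]_n -> R) : continuous f ->
  measurable_fun [set: 'rV[R]_n] f.
Proof.
move=> cf; apply: (measurability _ (RGenOpens.measurableE R)).
move=> _ [_ [a [b ->]] <-]; rewrite setTI; apply: open_measurable_rV.
by move/continuousP : cf; apply; exact: interval_open.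
Qed.

Lemma measurable_rVD d (T : measurableType d) (f g : T -> 'rV[R]_n) :
  measurable_fun setT f -> measurable_fun setT g ->
  measurable_fun setT (fun t => f t + g t).
Proof.
move=> mf mg; apply: measurable_fun_rV => i.
rewrite (_ : _ \o _ = (coord_rV i \o f) \+ (coord_rV i \o g)).
  by apply: measurable_funD; apply: measurableT_comp => //; exact: measurable_coord_rV.
by apply/funext => t /=; rewrite /coord_rV mxE.
Qed.

Lemma measurable_rVN d (T : measurableType d) (f : T -> 'rV[R]_n) :
  measurable_fun setT f -> measurable_fun setT (fun t => - f t).
Proof.
move=> mf; apply: measurable_fun_rV => i.
rewrite (_ : _ \o _ = \- (coord_rV i \o f)).
  by apply: measurable_funN; apply: measurableT_comp => //; exact: measurable_coord_rV.
by apply/funext => t /=; rewrite /coord_rV mxE.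
Qed.

Lemma measurable_rVB d (T : measurableType d) (f g : T -> 'rV[R]_n) :
  measurable_fun setT f -> measurable_fun setT g ->
  measurable_fun setT (fun t => f t - g t).
Proof. by move=> mf mg; apply: measurable_rVD => //; exact: measurable_rVN. Qed.

Lemma measurable_edot d (T : measurableType d) (f g : T -> 'rV[R]_n) :
  measurable_fun setT f -> measurable_fun setT g ->
  measurable_fun setT (fun t => edot (f t) (g t)).
Proof.
move=> mf mg; rewrite /edot; apply: measurable_sum => i.
apply: measurable_funM.
- exact: (measurableT_comp (measurable_coord_rV i) mf).
- exact: (measurableT_comp (measurable_coord_rV i) mg).
Qed.

Lemma measurable_sqrtr : measurable_fun [set: R] (@Num.sqrt R).
Proof. by apply: continuous_measurable_fun; exact: sqrt_continuous. Qed.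

Lemma measurable_enorm d (T : measurableType d) (f : T -> 'rV[R]_n) :
  measurable_fun setT f -> measurable_fun setT (fun t => enorm (f t)).
Proof.
move=> mf; apply: (measurableT_comp measurable_sqrtr).
exact: measurable_edot.
Qed.

End measurable_rV_theory.

Section edot_theory.
Context {R : realType} {n : nat}.
Implicit Types x y : 'rV[R]_n.

Lemma ler_norm_enorm x : `|x| <= enorm x.
Proof.
apply: normr_rV_le => [|i]; first exact: sqrtr_ge0.
rewrite /enorm -sqrtr_sqr ler_sqrt; last by apply: sumr_ge0 => j _; exact: sqr_ge0.
rewrite /edot (bigD1 i)//= -expr2 lerDl; apply: sumr_ge0 => j _; exact: sqr_ge0.
Qed.

Lemma ler_norm_edot x y : `|edot x y| <= n%:R * (`|x| * `|y|).
Proof.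
rewrite /edot (le_trans (ler_norm_sum _ _ _))//.
have -> : n%:R * (`|x| * `|y|) = \sum_(i < n) `|x| * `|y|.
  by rewrite sumr_const card_ord mulr_natl.
rewrite ler_sum// => i _; by rewrite normrM ler_pM// ler_coord_norm.
Qed.

Lemma edotDr x y z : edot x (y + z) = edot x y + edot x z.
Proof. by rewrite /edot -big_split/=; apply: eq_bigr => i _; rewrite mxE mulrDr. Qed.

Lemma edotZr x (c : R) y : edot x (c *: y) = c * edot x y.
Proof. by rewrite /edot mulr_sumr; apply: eq_bigr => i _; rewrite mxE mulrCA. Qed.

Lemma edotC x y : edot x y = edot y x.
Proof. by rewrite /edot; apply: eq_bigr => i _; rewrite mulrC. Qed.

Lemma edot_ge0 x : 0 <= edot x x.
Proof. by apply: sumr_ge0 => i _; exact: sqr_ge0. Qed.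

Lemma enorm_ge0 x : 0 <= enorm x. Proof. exact: sqrtr_ge0. Qed.

Lemma edotBr x y z : edot x (y - z) = edot x y - edot x z.
Proof. by rewrite edotDr -scaleN1r edotZr mulN1r. Qed.

(** Cauchy-Schwarz: the square of | |y| x - |x| y | expands to 2 |x| |y| (|x| |y| - x.y), and one
    divides by |x| |y|. If that product vanishes, the cruder [ler_norm_edot] already gives the
    claim. *)
Lemma edot_le_enorm x y : edot x y <= enorm x * enorm y.
Proof.
have := edot_ge0 (enorm y *: x - enorm x *: y).
rewrite edotBr edotC [edot (_ - _) (enorm x *: y)]edotC !edotBr !edotZr.
rewrite ![edot (_ *: x) _]edotC ![edot (_ *: y) _]edotC !edotZr (edotC y x).
have xE : enorm x ^+ 2 = edot x x by rewrite sqr_sqrtr ?edot_ge0.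
have yE : enorm y ^+ 2 = edot y y by rewrite sqr_sqrtr ?edot_ge0.
rewrite -xE -yE => q.
have [xy0|xy0] := eqVneq (enorm x * enorm y) 0.
  rewrite xy0 (le_trans (ler_norm _))// (le_trans (ler_norm_edot _ _))//.
  rewrite -(mulr0 n%:R) ler_wpM2l// -xy0 ler_pM//; exact: ler_norm_enorm.
have : 0 < enorm x * enorm y by rewrite lt_def xy0 mulr_ge0 ?enorm_ge0.
move=> xy; rewrite -subr_ge0 -(pmulr_rge0 _ xy); nra.
Qed.

End edot_theory.

(** * Translation invariance of Lebesgue measure *)

Section lebesgue_rV_theory.
Local Open Scope ereal_scope.
Context {R : realType}.
Notation leb := (@lebesgue_rV R _).

Lemma measurable_translate (a : R) : measurable_fun [set: R] (fun t => (t + a)%R).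
Proof. by apply: measurable_funD. Qed.

(** By uniqueness of Lebesgue measure it suffices to compare values on half-open intervals. *)
Lemma pushforward_lebesgue_translate (a : R) (A : set R) : measurable A ->
  lebesgue_measure ((fun t => (t + a)%R) @^-1` A) = lebesgue_measure A.
Proof.
move=> mA; apply/esym.
have ma := measurable_translate a.
rewrite (@lebesgue_measure_unique _ (pushforward lebesgue_measure
  ((fun t : measurableTypeR R => (t + a)%R) : _ -> measurableTypeR R)))//.
move=> _ [[x y] _ <-]/=.
rewrite /pushforward (_ : _ @^-1` _ = [set` `](x - a)%R, (y - a)%R]]); last first.
  apply/seteqP; split => t /=; rewrite !in_itv/= => /andP[h1 h2]; apply/andP; split;
    by rewrite ?ltrBlDr ?lerBrDr// -?ltrBlDr -?lerBrDr.
have := lebesgue_measure_itv `](x - a)%R, (y - a)%R].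
have := lebesgue_measure_itv `]x, y] => -> -> /=.
by rewrite !lte_fin ltrD2r -!EFinB opprB addrA subrK.
Qed.

Lemma ge0_integral_translate1 (a : R) (F : R -> \bar R) :
  measurable_fun setT F -> (forall x, 0 <= F x) ->
  \int[lebesgue_measure]_t F (t + a)%R = \int[lebesgue_measure]_t F t.
Proof.
move=> mF F0; have ma := measurable_translate a.
have := @ge0_integral_pushforward _ _ (measurableTypeR R) (measurableTypeR R) R _ ma
  lebesgue_measure setT F measurableT mF (fun y _ => F0 y).
rewrite preimage_setT => <-; apply: eq_measure_integral => A mA _.
exact: pushforward_lebesgue_translate.
Qed.

Lemma ge0_integral_consE n (F : 'rV[R]_n.+1 -> \bar R) :
  measurable_fun setT F -> (forall x, 0 <= F x) ->
  \int[lebesgue_rV n.+1]_x F x =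
  \int[lebesgue_measure]_t \int[lebesgue_rV n]_x F (cons_rV (t, x)).
Proof.
move=> mF F0; rewrite /=.
rewrite (ge0_integral_pushforward (@measurable_cons_rV R n))//= preimage_setT.
rewrite (fubini_tonelli1 (F \o @cons_rV R n))//; last by move=> ?; exact: F0.
exact: measurableT_comp mF (@measurable_cons_rV R n).
Qed.

(** Induction on the dimension through Tonelli: for each fixed first coordinate the tail is handled
    by the induction hypothesis, and the first coordinate by the one-dimensional case. *)
Lemma ge0_integral_translate n (a : 'rV[R]_n) (F : 'rV[R]_n -> \bar R) :
  measurable_fun setT F -> (forall x, 0 <= F x) ->
  \int[lebesgue_rV n]_x F (x + a)%R = \int[lebesgue_rV n]_x F x.
Proof.
elim: n a F => [|n IH] a F mF F0.
  by apply: eq_integral => x _; congr F; apply/rowP; case.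
have mFa : measurable_fun setT (fun x : 'rV[R]_n.+1 => F (x + a)%R).
  by apply: (measurableT_comp mF); apply: measurable_rVD.
rewrite (ge0_integral_consE mF F0) (ge0_integral_consE mFa (fun x => F0 _)).
pose b := (\row_j a ord0 (lift ord0 j))%R.
have consD t x : (cons_rV (t, x) + a)%R = cons_rV ((t + a ord0 ord0)%R, (x + b)%R).
  apply/rowP => i; rewrite !mxE; case: unliftP => [j ->|->] //=.
  by rewrite !mxE.
under eq_integral do under eq_integral do rewrite consD.
have mFc (t : R) : measurable_fun setT (fun x => F (cons_rV (t, x))).
  apply: (measurableT_comp mF); apply: (measurableT_comp (@measurable_cons_rV R n)).
  exact: measurable_pair1.
under eq_integral do rewrite (IH b (fun x => F (cons_rV (_, x))))//.
rewrite (@ge0_integral_translate1 _ (fun t =>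
  \int[lebesgue_rV n]_x F (cons_rV (t, x))))//.
  apply: (measurable_fun_fubini_tonelli_F (F \o @cons_rV R n)) => //.
    exact: measurableT_comp mF (@measurable_cons_rV R n).
  by move=> ?; exact: F0.
by move=> x; apply: integral_ge0.
Qed.

Lemma integral_translate n (a : 'rV[R]_n) (F : 'rV[R]_n -> \bar R) :
  measurable_fun setT F ->
  \int[lebesgue_rV n]_x F (x + a)%R = \int[lebesgue_rV n]_x F x.
Proof.
move=> mF; rewrite integralE [RHS]integralE.
have mp := measurable_funepos mF; have mn := measurable_funeneg mF.
rewrite -(ge0_integral_translate a mp)// -(ge0_integral_translate a mn)//.
by congr (_ - _); apply: eq_integral => x _; rewrite ?funeposE ?funenegE.
Qed.

Lemma integrable_translate n (a : 'rV[R]_n) (F : 'rV[R]_n -> \bar R) :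
  (lebesgue_rV n).-integrable setT F ->
  (lebesgue_rV n).-integrable setT (fun x => F (x + a)%R).
Proof.
move=> /integrableP[mF iF]; apply/integrableP; split.
  by apply: (measurableT_comp mF); apply: measurable_rVD.
rewrite (@ge0_integral_translate _ a (abse \o F))//; first exact: measurableT_comp.
by move=> x /=.
Qed.

(** Balls of the sup norm are cubes, so the product formula for boxes applies. *)
Lemma lebesgue_rV_cball n (r : R) : (0 <= r)%R ->
  lebesgue_rV n [set x : 'rV[R]_n | (`|x| <= r)%R] = ((2 * r) ^+ n)%:E.
Proof.
move=> r0.
have -> : [set x : 'rV[R]_n | (`|x| <= r)%R] =
    [set x : 'rV[R]_n | forall i, [set` `[(- r)%R, r]%R] (x ord0 i)].
  apply/seteqP; split => x /= xr.
    by move=> i; rewrite in_itv/= -ler_norml (le_trans (ler_coord_norm _ _)).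
  by apply: normr_rV_le => // i; rewrite ler_norml; have := xr i; rewrite in_itv.
rewrite (@lebesgue_rV_box _ _ (fun=> [set` `[(- r)%R, r]%R])); last first.
  by move=> i; exact: measurable_itv.
under eq_bigr do rewrite lebesgue_measure_itv/= lte_fin.
have -> : (if (- r < r)%R then (r%:E - (- r)%:E) else 0) = (2 * r)%:E :> \bar R.
  have [h|h] := ltP (- r)%R r; first by rewrite -EFinB opprK mulr_natl mulr2n.
  suff -> : r = 0%R by rewrite mulr0.
  lra.
by rewrite prodEFin prodr_const card_ord.
Qed.

Lemma measurable_norm_rV n : measurable_fun [set: 'rV[R]_n] (fun x => `|x|%R).
Proof. by apply: continuous_measurable_rV; exact: norm_continuous. Qed.

Lemma lebesgue_rV_cball_lty n (r : R) :
  lebesgue_rV n [set x : 'rV[R]_n | (`|x| <= r)%R] < +oo.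
Proof.
have [r0|r0] := leP 0%R r; first by rewrite lebesgue_rV_cball// ltry.
rewrite (_ : [set _ | _] = set0) ?measure0//.
by apply/seteqP; split => // x /= /(le_trans (normr_ge0 _)); rewrite leNgt r0.
Qed.

Lemma measurable_cball_rV n (r : R) : measurable [set x : 'rV[R]_n | (`|x| <= r)%R].
Proof.
rewrite -[X in measurable X]setTI (_ : [set x | _] = (fun x => `|x|%R) @^-1` `]-oo, r]%classic).
  by apply: (@measurable_norm_rV n) => //; exact: measurable_itv.
by apply/seteqP; split => x /=; rewrite in_itv.
Qed.

Lemma integral_indic_cball_rV n (r : R) : (0 <= r)%R ->
  \int[lebesgue_rV n]_x (\1_[set x : 'rV[R]_n | (`|x| <= r)%R] x)%:E = ((2 * r) ^+ n)%:E.
Proof.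
move=> r0; rewrite integral_indic//; last exact: measurable_cball_rV.
by rewrite setIT; exact: lebesgue_rV_cball.
Qed.

(** [Lnorm] at infinity unfolds to the essential supremum only when the whole space has positive
    measure; this opens the bound in [test_field]. *)
Lemma lebesgue_rV_setT_gt0 n : 0 < lebesgue_rV n [set: 'rV[R]_n].
Proof.
rewrite (lt_le_trans (y := lebesgue_rV n [set x : 'rV[R]_n | (`|x| <= 1)%R]))//.
  by rewrite lebesgue_rV_cball// lte_fin exprn_gt0// mulr_gt0.
by rewrite le_measure ?inE//; exact: measurable_cball_rV.
Qed.

End lebesgue_rV_theory.

Lemma indic_setDI (R : realType) (T : Type) (B C D : set T) : D `<=` C ->
  \1_((C `\` D) `&` B) = (\1_(C `&` B) \- \1_(D `&` B))%R :> (T -> R).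
Proof.
move=> DC; apply/funext => x; rewrite /= !indicE in_setI in_setD !in_setI.
have [xD|xD] := boolP (x \in D); rewrite /= ?andbF ?andbT ?subr0//=.
by rewrite (_ : x \in C) ?subrr//; apply/mem_set/DC/set_mem.
Qed.

(** * Continuity of translations in L^1 *)

Section l1_translation.
Local Open Scope ereal_scope.
Context {R : realType} {n : nat}.
Notation leb := (@lebesgue_rV R n).
Notation "f \in_L1" := (leb.-integrable [set: 'rV[R]_n] (EFin \o f)) (at level 10).
Implicit Types (f g : 'rV[R]_n -> R) (a h : 'rV[R]_n).

Definition l1dist f g : \bar R := \int[leb]_x (`|f x - g x|)%:E.

Definition translate a f : 'rV[R]_n -> R := fun x => f (x + a)%R.

Definition L1_translation_continuous f := forall e : R, (0 < e)%R ->
  exists2 d : R, (0 < d)%R &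
    forall h, (`|h| <= d)%R -> l1dist (translate h f) f <= e%:E.

Lemma measurable_l1 f : f \in_L1 -> measurable_fun setT f.
Proof. by move=> /integrableP[/measurable_EFinP]. Qed.

Lemma L1Zl (c : R) f : f \in_L1 -> (fun x => c * f x)%R \in_L1.
Proof.
by move=> fL1; rewrite /comp; under eq_fun do rewrite EFinM; exact: integrableZl.
Qed.

Lemma L1Zr (c : R) f : f \in_L1 -> (fun x => f x * c)%R \in_L1.
Proof. by move=> /(L1Zl c); under eq_fun do rewrite mulrC. Qed.

Lemma L1D f g : f \in_L1 -> g \in_L1 -> (fun x => f x + g x)%R \in_L1.
Proof.
by move=> fL1 gL1; rewrite /comp; under eq_fun do rewrite EFinD; exact: integrableD.
Qed.

Lemma L1B f g : f \in_L1 -> g \in_L1 -> (fun x => f x - g x)%R \in_L1.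
Proof.
by move=> fL1 gL1; rewrite /comp; under eq_fun do rewrite EFinB; exact: integrableB.
Qed.

Lemma measurable_l1dist f g : measurable_fun setT f -> measurable_fun setT g ->
  measurable_fun setT (fun x => (`|f x - g x|)%:E).
Proof.
move=> mf mg; apply/measurable_EFinP; apply: measurableT_comp => //.
exact: measurable_funB.
Qed.

Lemma measurable_fun_translate a f : measurable_fun setT f ->
  measurable_fun setT (translate a f).
Proof. by move=> mf; apply: (measurableT_comp mf); exact: measurable_rVD. Qed.

Lemma l1_translate a f : f \in_L1 -> (translate a f) \in_L1.
Proof. exact: (@integrable_translate R n a (EFin \o f)). Qed.

Lemma l1dist_translate a f g : measurable_fun setT f -> measurable_fun setT g ->
  l1dist (translate a f) (translate a g) = l1dist f g.
Proof.
move=> mf mg.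
by rewrite /l1dist -[RHS](ge0_integral_translate a (measurable_l1dist mf mg)).
Qed.

Lemma l1distC f g : l1dist f g = l1dist g f.
Proof. by apply: eq_integral => x _; rewrite distrC. Qed.

Lemma l1dist_triangle f g k : measurable_fun setT f -> measurable_fun setT g ->
  measurable_fun setT k -> l1dist f k <= l1dist f g + l1dist g k.
Proof.
move=> mf mg mk; rewrite /l1dist -ge0_integralD//; last 2 first.
- exact: measurable_l1dist.
- exact: measurable_l1dist.
apply: ge0_le_integral => //.
- exact: measurable_l1dist.
- by apply: emeasurable_funD; exact: measurable_l1dist.
- by move=> x _; rewrite -EFinD lee_fin ler_distD.
Qed.

(** Translation is an isometry of L^1, so the property passes to L^1 limits by splitting [e] in
    three. *)
Lemma L1_translation_continuous_approx f : f \in_L1 ->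
  (forall e : R, (0 < e)%R -> exists g, [/\ g \in_L1, L1_translation_continuous g &
     l1dist f g <= e%:E]) ->
  L1_translation_continuous f.
Proof.
move=> /measurable_l1 mf fg e e0; have e3 : (0 < e / 3)%R by rewrite divr_gt0.
have [g [/measurable_l1 mg gc fge]] := fg _ e3.
have [d d0 gd] := gc _ e3; exists d => // h /gd {}gd.
have mfh := measurable_fun_translate h mf; have mgh := measurable_fun_translate h mg.
rewrite (le_trans (l1dist_triangle mfh mgh mf))//.
have -> : e = (e / 3 + (e / 3 + e / 3))%R by lra.
rewrite EFinD leeD//; first by rewrite l1dist_translate.
by rewrite (le_trans (l1dist_triangle mgh mg mf))// EFinD leeD// l1distC.
Qed.

Lemma L1_translation_continuous_cst0 : L1_translation_continuous (fun=> 0%R).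
Proof.
move=> e e0; exists 1%R => // h _; rewrite /l1dist /translate.
under eq_integral do rewrite subrr normr0.
by rewrite integral0 lee_fin ltW.
Qed.

Lemma L1_translation_continuousD f g : f \in_L1 -> g \in_L1 ->
  L1_translation_continuous f -> L1_translation_continuous g ->
  L1_translation_continuous (f \+ g)%R.
Proof.
move=> /measurable_l1 mf /measurable_l1 mg fc gc e e0.
have e2 : (0 < e / 2)%R by rewrite divr_gt0.
have [d1 d10 fd] := fc _ e2; have [d2 d20 gd] := gc _ e2.
exists (Num.min d1 d2); first by rewrite lt_min d10.
move=> h; rewrite le_min => /andP[/fd hf /gd hg].
have mfh := measurable_fun_translate h mf; have mgh := measurable_fun_translate h mg.
have mF := measurable_l1dist mfh mf; have mG := measurable_l1dist mgh mg.
rewrite [e]splitr EFinD (le_trans _ (leeD hf hg))// /l1dist -ge0_integralD//.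
apply: ge0_le_integral => //.
- by apply: measurable_l1dist; apply: measurable_funD.
- exact: emeasurable_funD.
- move=> x _; rewrite -EFinD lee_fin /translate/=.
  by rewrite opprD addrACA ler_normD.
Qed.

Lemma L1_translation_continuousZ (c : R) f : f \in_L1 ->
  L1_translation_continuous f -> L1_translation_continuous (fun x => c * f x)%R.
Proof.
move=> /measurable_l1 mf fc e e0.
(* The added 1 avoids a division by zero when [c] is 0. *)
have c1 : (0 < `|c| + 1)%R by rewrite ltr_wpDl.
have [d d0 fd] := fc (e / (`|c| + 1))%R (divr_gt0 e0 c1).
exists d => // h /fd hf.
have mfh := measurable_fun_translate h mf; have mF := measurable_l1dist mfh mf.
rewrite /l1dist; under eq_integral do rewrite /translate -mulrBr normrM EFinM.
rewrite ge0_integralZl_EFin//.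
rewrite (@le_trans _ _ (`|c|%:E * (e / (`|c| + 1))%:E))//.
  by rewrite lee_wpmul2l// lee_fin.
rewrite -EFinM lee_fin mulrCA ger_pMr// ler_pdivrMr// mul1r lerDl//.
Qed.

Lemma L1_translation_continuousB f g : f \in_L1 -> g \in_L1 ->
  L1_translation_continuous f -> L1_translation_continuous g ->
  L1_translation_continuous (f \- g)%R.
Proof.
move=> f1 g1 fc gc.
rewrite (_ : (f \- g)%R = (f \+ (fun x => -1 * g x))%R); last first.
  by apply/funext => x /=; rewrite mulN1r.
apply: L1_translation_continuousD => //; last exact: L1_translation_continuousZ.
by rewrite /comp; under eq_fun do rewrite EFinM; exact: integrableZl.
Qed.

(** This is |u - v| = 2 (v - u)^+ + (u - v) with the subtraction moved across: for nonnegative u and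
    v both sides are sums of nonnegative terms and can be integrated in the extended reals. *)
Lemma normrBD_max (u v : R) : (`|u - v| + v = 2 * Num.max (v - u) 0 + u)%R.
Proof.
have [uv|uv] := leP (v - u)%R 0%R.
- by rewrite ger0_norm; lra.
- by rewrite ltr0_norm; lra.
Qed.

Lemma l1_indic (U : set 'rV[R]_n) : measurable U -> leb U < +oo ->
  (\1_U : _ -> R) \in_L1.
Proof.
move=> mU Uoo; apply/integrableP; split; first exact/measurable_EFinP.
under eq_integral do rewrite gee0_abs ?lee_fin//=.
by rewrite integral_indic// setIT.
Qed.

(* The increments of 1_U along h have zero integral, so their L^1 norm is twice
   the integral of the positive part of 1_U - 1_U(. + h), which is dominated by
   1_U and tends to zero pointwise because U is open. *)
Lemma L1_translation_continuous_open (U : set 'rV[R]_n) : open U -> leb U < +oo ->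
  L1_translation_continuous (\1_U : _ -> R).
Proof.
move=> oU Uoo.
have mU := open_measurable_rV oU.
have mU' : measurable_fun setT (\1_U : 'rV[R]_n -> R) by [].
have iU := l1_indic mU Uoo.
(* Arguing by contradiction yields a sequence of bad translations tending to 0, to which dominated
   convergence applies. *)
apply: contrapT => /existsNP[e] /not_implyP[e0] nd.
have /choice[h hP] : forall k : nat, exists h : 'rV[R]_n,
    (`|h| <= k.+1%:R^-1)%R /\ e%:E < l1dist (translate h \1_U) \1_U.
  move=> k; apply: contrapT => /forallNP H; apply: nd; exists k.+1%:R^-1%R.
    by rewrite invr_gt0 ltr0n.
  by move=> h hk; rewrite leNgt; apply/negP => he; exact: (H h).
pose F k x : \bar R := (Num.max (\1_U x - \1_U (x + h k)) 0)%:E%R.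
have mF k : measurable_fun setT (F k).
  apply/measurable_EFinP; apply: measurable_maxr => //.
  by apply: measurable_funB => //; exact: measurable_fun_translate.
have F_ge0 k x : 0 <= F k x by rewrite lee_fin le_max lexx orbT.
have F0 x : F ^~ x @ \oo --> 0%E.
  have [Ux|Ux] := pselect (U x); last first.
    rewrite (_ : F ^~ x = cst 0); first exact: cvg_cst.
    apply/funext => k; rewrite /F indicE memNset// sub0r max_r// oppr_le0 //.
  have /nbhs_ballP[d /= d0 xdU] : nbhs x U by exact: open_nbhs_nbhs.
  have [N _ HN] := near_infty_natSinv_lt (PosNum d0).
  apply: cvg_near_cst; exists N => // k Nk.
  rewrite /F !indicE !mem_set ?subrr ?maxxx//; apply: xdU.
  rewrite mx_norm_ball /ball_/= opprD addNKr normrN.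
  by rewrite (le_lt_trans (hP k).1)//; exact: HN.
have FU x k : `|F k x| <= (EFin \o \1_U) x.
  by rewrite gee0_abs// lee_fin ge_max lerBlDr lerDl; apply/andP.
have [_ _] := @dominated_convergence _ _ _ leb setT measurableT F (fun=> 0) (EFin \o \1_U)
  mF (measurable_cst _) (aeW _ (fun x _ => F0 x)) iU (aeW _ (fun x k _ => FU x k)).
rewrite integral0 => cvF.
have FE k : l1dist (translate (h k) \1_U) \1_U = 2%:E * \int[leb]_x F k x.
  have mUh := measurable_fun_translate (h k) mU'.
  have iUh := l1_translate (h k) iU.
  have eqU : \int[leb]_x (translate (h k) \1_U x)%:E = \int[leb]_x (\1_U x : R)%:E.
    by have /measurable_EFinP := mU'; exact: (@integral_translate R n (h k) (EFin \o \1_U)).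
  have fU : \int[leb]_x (\1_U x : R)%:E \is a fin_num by exact: integrable_fin_num.
  have : l1dist (translate (h k) \1_U) \1_U + \int[leb]_x (\1_U x : R)%:E =
      2%:E * (\int[leb]_x F k x) + \int[leb]_x (\1_U x : R)%:E.
    rewrite -[in RHS]eqU -ge0_integralZl_EFin// /l1dist -!ge0_integralD//.
    - apply: eq_integral => x _; rewrite /F -EFinM -!EFinD; congr EFin.
      rewrite /translate; set u := (\1_U (x + h k) : R)%R; set v := (\1_U x : R)%R.
      exact: normrBD_max.
    - by move=> x _; rewrite mule_ge0.
    - exact: measurable_funeM.
    - by move=> x _; rewrite lee_fin /translate.
    - exact/measurable_EFinP.
    - exact: measurable_l1dist.
    - exact/measurable_EFinP.
  by move/(congr1 (fun z => z - \int[leb]_x (\1_U x : R)%:E)); rewrite !addeK.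
have : \forall k \near \oo, \int[leb]_x F k x < (e / 2)%:E.
  have : nbhs (0 : \bar R) [set y | y < (e / 2)%:E].
    apply: open_nbhs_nbhs; split; first exact: open_ereal_lt_ereal.
    by rewrite /= lte_fin divr_gt0.
  by move/cvF.
move=> [N _ /(_ N (leqnn N))] /= FN.
have := (hP N).2; rewrite FE; apply/negP; rewrite -leNgt.
rewrite [e in leRHS](_ : e = 2 * (e / 2))%R; last by lra.
by rewrite EFinM lee_pmul2l// ltW.
Qed.

(** The open sets form a class stable under intersection, as the pi-lambda argument requires of a
    generator. *)
Lemma measurable_rVE : @measurable _ 'rV[R]_n = <<s @open 'rV[R]_n >>.
Proof.
apply/seteqP; split; last first.
  apply: smallest_sub; first exact: sigma_algebra_measurable.
  by move=> U; exact: open_measurable_rV.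
apply: smallest_sub; first exact: smallest_sigma_algebra.
rewrite -bigcup_seq/=; apply: bigcup_sub => i _ _ [Y mY <-].
rewrite setTI; have mi : measurable_fun setT
    (fun x : g_sigma_algebraType (@open 'rV[R]_n) => (x : 'rV[R]_n) ord0 i : R).
  apply: (measurability _ (RGenOpens.measurableE R)).
  move=> _ [_ [a [b ->]] <-]; rewrite setTI; apply: sub_sigma_algebra.
  have /continuousP := @coord_continuous R 1 n ord0 i; apply; exact: interval_open.
by have := mi measurableT Y mY; rewrite setTI.
Qed.

(** By dominated convergence the indicators of [F k] tend in L^1 to that of the union, which has
    finite measure, so [L1_translation_continuous_approx] applies. *)
Lemma L1_translation_continuous_ndseq (F : (set 'rV[R]_n)^nat) :
  (forall k, measurable (F k)) -> nondecreasing_seq F ->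
  leb (\bigcup_k F k) < +oo ->
  (forall k, L1_translation_continuous (\1_(F k) : _ -> R)) ->
  L1_translation_continuous (\1_(\bigcup_k F k) : _ -> R).
Proof.
move=> mF ndF Foo Fc; set A := \bigcup_k F k.
have mA : measurable A by exact: bigcup_measurable.
have iA := l1_indic mA Foo.
apply: L1_translation_continuous_approx => // e e0.
have FA x : (fun k => (\1_(F k) x : R)%:E) @ \oo --> (\1_A x : R)%:E.
  have [Ax|Ax] := pselect (A x); last first.
    rewrite (_ : (fun _ => _) = cst 0); last first.
      by apply/funext => k; rewrite indicE memNset//; apply: contra_not Ax => Fx; exists k.
    by rewrite indicE memNset//; exact: cvg_cst.
  have [N _ FN] := Ax.
  apply: cvg_near_cst; exists N => // k Nk.
  rewrite !indicE !mem_set//; have /subsetPset := ndF _ _ Nk; exact.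
have FleA x k : `|(\1_(F k) x : R)%:E| <= (EFin \o \1_A) x.
  rewrite gee0_abs ?lee_fin// !indicE; have [Fx|Fx] := boolP (x \in F k) => //.
  by rewrite mem_set//; exists k => //; exact: set_mem.
have mF' k : measurable_fun setT (fun x => (\1_(F k) x : R)%:E).
  exact/measurable_EFinP.
have mA' : measurable_fun setT (fun x => (\1_A x : R)%:E) by exact/measurable_EFinP.
have [_ cv _] := @dominated_convergence _ _ _ leb setT measurableT
  (fun k x => (\1_(F k) x : R)%:E) (fun x => (\1_A x : R)%:E) (EFin \o \1_A)
  mF' mA' (aeW _ (fun x _ => FA x)) iA (aeW _ (fun x k _ => FleA x k)).
have : \forall k \near \oo, l1dist (\1_A) (\1_(F k)) < e%:E.
  move: cv => /(_ [set y | y < e%:E]); rewrite /= => cv.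
  have /cv[N _ HN] : nbhs (0 : \bar R) [set y | y < e%:E].
    by apply: open_nbhs_nbhs; split; [exact: open_ereal_lt_ereal|rewrite /= lte_fin].
  by exists N => // k /HN /=; rewrite l1distC.
move=> [N _ /(_ N (leqnn N))] /= /ltW AN; exists (\1_(F N)); split => //.
apply: l1_indic => //; rewrite (le_lt_trans _ Foo)// le_measure ?inE//.
exact: bigcup_sup.
Qed.

Lemma open_ball_rV (r : R) : open [set x : 'rV[R]_n | (`|x| < r)%R].
Proof. by have /continuousP/(_ _ (@open_lt R r)) := @norm_continuous R 'rV[R]_n. Qed.

(** Pi-lambda argument starting from the open sets. Cutting with a fixed ball keeps all measures
    finite, so that the indicators of differences and of increasing unions stay in L^1. *)
Lemma L1_translation_continuous_bounded (r : R) (A : set 'rV[R]_n) : measurable A ->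
  L1_translation_continuous (\1_(A `&` [set x : 'rV[R]_n | (`|x| < r)%R]) : _ -> R).
Proof.
set B := [set x | _] => mA.
have mB : measurable B by apply: open_measurable_rV; exact: open_ball_rV.
have Boo : leb B < +oo.
  rewrite (le_lt_trans _ (lebesgue_rV_cball_lty n r))// le_measure ?inE//.
    exact: measurable_cball_rV.
  by move=> x /ltW.
have finB C : measurable C -> leb (C `&` B) < +oo.
  by move=> mC; rewrite (le_lt_trans _ Boo)// le_measure ?inE//; exact: measurableI.
pose H := [set A | measurable A /\ L1_translation_continuous (\1_(A `&` B) : _ -> R)].
suff : <<s @open 'rV[R]_n >> `<=` H by rewrite -measurable_rVE => /(_ _ mA)[].
apply: lambda_system_subset => //.
- by move=> U V oU oV; exact: openI.
- split => //.
  + split => //; rewrite setTI; apply: L1_translation_continuous_open => //.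
    exact: open_ball_rV.
  + move=> C D DC [mC Cc] [mD Dc]; split; first exact: measurableD.
    rewrite (indic_setDI _ _ DC).
    by apply: L1_translation_continuousB => //; apply: l1_indic => //;
      [exact: measurableI|exact: finB|exact: measurableI|exact: finB].
  + move=> F ndF HF; split.
      by apply: bigcup_measurable => k _; have [] := HF k.
    rewrite setI_bigcupl; apply: L1_translation_continuous_ndseq => [k|k l kl||k].
    * by apply: measurableI => //; have [] := HF k.
    * by apply/subsetPset; apply: setSI; exact/subsetPset/ndF.
    * rewrite -setI_bigcupl; apply: finB; apply: bigcup_measurable => k _.
      by have [] := HF k.
    * by have [] := HF k.
- move=> U oU; split; first exact: open_measurable_rV.
  apply: L1_translation_continuous_open; last first.
    by apply: finB; exact: open_measurable_rV.
  by apply: openI => //; exact: open_ball_rV.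
Qed.

Lemma L1_translation_continuous_indic (A : set 'rV[R]_n) : measurable A ->
  leb A < +oo -> L1_translation_continuous (\1_A : _ -> R).
Proof.
move=> mA Aoo; pose B k := [set x : 'rV[R]_n | (`|x| < k%:R)%R].
have AE : A = \bigcup_k (A `&` B k).
  apply/seteqP; split => [x Ax|x [k _ []//]].
  exists (Num.truncn `|x|).+1 => //; split => //; exact: truncnS_gt.
rewrite AE; apply: L1_translation_continuous_ndseq => [k|k l kl||k].
- by apply: measurableI => //; apply: open_measurable_rV; exact: open_ball_rV.
- apply/subsetPset => x [Ax] xk; split => //.
  by apply: (lt_le_trans xk); rewrite ler_nat.
- by rewrite -AE.
- exact: L1_translation_continuous_bounded.
Qed.

Import HBSimple.

(** In an integrable simple function each nonzero value is taken on a set of finite measure; the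
    value 0 may be taken on an infinite one, but its term vanishes. *)
Lemma L1_translation_continuous_sfun (g : {sfun 'rV[R]_n >-> R}) :
  g \in_L1 -> L1_translation_continuous g.
Proof.
move=> gi.
have cgi (r : R) : r != 0%R -> leb (g @^-1` [set r]) < +oo.
  move=> r0; have [_ igoo] := integrableP _ _ _ gi.
  have : `|r|%:E * leb (g @^-1` [set r]) < +oo.
    apply: le_lt_trans igoo; rewrite -[X in _ * leb X]setIT -integral_indic//.
    rewrite -ge0_integralZl_EFin//; last exact/measurable_EFinP.
    apply: ge0_le_integral => //.
    - by apply: measurable_funeM; exact/measurable_EFinP.
    - by apply: measurableT_comp => //; exact: measurable_int gi.
    - move=> x _; rewrite -EFinM lee_fin indicE.
      have [xr|] := boolP (x \in _); rewrite ?mulr0// mulr1.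
      by rewrite (set_mem xr).
  by rewrite !ltey; apply: contra => /eqP ->; rewrite gt0_muley// lte_fin normr_gt0.
have /funext -> := fimfunEord g; set s := fset_set _.
(* The enumeration of the values of [g] is replaced with an arbitrary finite family, so that the
   induction on its length can drop a term. *)
suff : forall m (r : 'I_m -> R),
    let k := fun x => (\sum_(i < m) (r i * \1_(g @^-1` [set r i]) x))%R in
    k \in_L1 /\ L1_translation_continuous k.
  by move=> H; exact: (H _ (fun i => (finmap.enum_fset s)`_i)).2.
elim => [|m IH] r /=.
  under eq_fun do rewrite big_ord0; split; last exact: L1_translation_continuous_cst0.
  exact: integrable0.
under eq_fun do rewrite big_ord_recr/=.
have [i1 c1] := IH (fun i => r (widen_ord (leqnSn m) i)).
pose u x := (r ord_max * \1_(g @^-1` [set r ord_max]) x)%R.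
suff [i2 c2] : u \in_L1 /\ L1_translation_continuous u.
  split; last exact: L1_translation_continuousD.
  rewrite /comp/=; under eq_fun do rewrite EFinD; exact: integrableD.
rewrite /u; have [r0|/cgi roo] := eqVneq (r ord_max) 0%R.
  rewrite (_ : (fun _ => _) = (fun=> 0%R)); last first.
    by apply/funext => x; rewrite r0 mul0r.
  by split; [exact: integrable0|exact: L1_translation_continuous_cst0].
have i2 : (\1_(g @^-1` [set r ord_max]) : _ -> R) \in_L1 by exact: l1_indic.
split; last by apply: L1_translation_continuousZ => //; exact: L1_translation_continuous_indic.
by rewrite /comp/=; under eq_fun do rewrite EFinM; exact: integrableZl.
Qed.

Lemma L1_translation_continuousP f : f \in_L1 -> L1_translation_continuous f.
Proof.
move=> fL1; apply: L1_translation_continuous_approx => // e e0.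
have [g [gi _ gf]] := approximation_sfun_integrable measurableT fL1.
have : nbhs (0 : \bar R) [set y | y < e%:E].
  by apply: open_nbhs_nbhs; split; [exact: open_ereal_lt_ereal|rewrite /= lte_fin].
move=> /gf[N _ /(_ N (leqnn N))] /= /ltW fN.
exists (g N); split => //.
by apply: L1_translation_continuous_sfun; exact: gi.
Qed.

End l1_translation.

(** * The weight min(|h|, 1) / |h|^(n + alpha) *)

Section singular_kernel.
Context {R : realType}.

Lemma exists_dyadic (y : R) : 1 <= y -> exists k, 2 ^+ k <= y < 2 ^+ k.+1.
Proof.
move=> y1; have y0 : 0 <= y by rewrite (le_trans ler01).
have t0 : (0 < Num.truncn y)%N by rewrite truncn_gt0.
have /andP[k1 k2] := @trunc_log_bounds 2 (Num.truncn y) isT t0.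
exists (trunc_log 2 (Num.truncn y)).
have /andP[ty yt] := truncn_itv y0.
apply/andP; split; first by rewrite (le_trans _ ty)// -natrX ler_nat.
by rewrite (lt_le_trans yt)// -natrX ler_nat.
Qed.

Lemma nneseries_geometric_lty (C q : R) : 0 <= C -> 0 <= q < 1 ->
  (\sum_(k <oo) (C * q ^+ k)%:E < +oo)%E.
Proof.
move=> C0 /andP[q0 q1].
apply: (@le_lt_trans _ _ (C / (1 - q))%:E); last exact: ltry.
apply: lime_le.
  by apply: is_cvg_nneseries => k _ _; rewrite lee_fin mulr_ge0// exprn_ge0.
apply: nearW => k; rewrite sumEFin lee_fin.
have /geometric_seriesE : q != 1 by rewrite lt_eqF.
move=> /(_ C)/(congr1 (@^~ k)); rewrite /series /geometric/= => ->.
have q10 : 0 < 1 - q by rewrite subr_gt0.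
by rewrite ler_pM2r ?invr_gt0// ler_piMr// lerBlDr lerDl exprn_ge0.
Qed.

(** Majorant, up to a constant, of the integrand of [fdiv] in h = y - x: the increment of phi is at
    most a multiple of min(|h|, 1), and the factor h of the scalar product cancels one power in the
    denominator. *)
Definition frac_weight n (alpha : R) (h : 'rV[R]_n) : R :=
  Num.min `|h| 1 / `|h| `^ (n%:R + alpha).

Lemma frac_weight_ge0 n alpha (h : 'rV[R]_n) : 0 <= frac_weight alpha h.
Proof. by rewrite /frac_weight divr_ge0 ?powR_ge0// le_min normr_ge0/=. Qed.

Lemma measurable_frac_weight n alpha : measurable_fun setT (@frac_weight n alpha).
Proof.
rewrite /frac_weight; under eq_fun do rewrite -powRN.
apply: measurable_funM; first by apply: measurable_minr => //; exact: measurable_norm_rV.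
apply: (measurableT_comp (measurable_powR _)); exact: measurable_norm_rV.
Qed.

Let cancel_mid (a b u q w v : R) : u != 0 ->
  a * b * (u * q) * (w * (u^-1 * v)) = w * (a * b) * (q * v).
Proof. by move=> u0; rewrite -[RHS]mulr1 -(divff u0); lra. Qed.

Let cancel_left (u q w : R) : u != 0 -> u^-1 * q * (w * u) = w * q.
Proof. by move=> u0; rewrite -[RHS]mulr1 -(divff u0); lra. Qed.

(* Here p = 2^alpha.  The weight is at most (2^(n-1) p)^(k+1) on the annulus where |h| ~ 2^-k
   and at most (2^n p)^-k where |h| ~ 2^k, so the integrals over dyadic annuli are bounded by
   geometric series of ratios p / 2 and 1 / p, both less than 1. *)
Section dyadic_bound.
Variables (n : nat) (alpha p : R).
Hypotheses (n_gt0 : (0 < n)%N) (alpha_gt0 : 0 < alpha) (p_gt1 : 1 < p) (p_lt2 : p < 2).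
Hypothesis pX : forall k, (2 ^+ k) `^ alpha = p ^+ k.

Let p_gt0 : 0 < p. Proof. by rewrite (lt_trans ltr01). Qed.

Let expn_pred (t : R) : t ^+ n = t * t ^+ n.-1.
Proof. by rewrite -exprS prednK. Qed.

Let powRDn (t : R) : 0 < t -> t `^ (n%:R + alpha) = t ^+ n * t `^ alpha.
Proof.
move=> t0; rewrite powRD; last by rewrite (gt_eqF t0) implybT.
by rewrite powR_mulrn// ltW.
Qed.

Let near_bound k (h : 'rV[R]_n) : 2 ^+ k <= `|h|^-1 < 2 ^+ k.+1 -> h != 0 -> `|h| <= 1 ->
  frac_weight alpha h <= (2 ^+ n.-1 * p) ^+ k.+1.
Proof.
move=> /andP[h1 h2] h0 hle1; have hp : 0 < `|h| by rewrite normr_gt0.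
rewrite /frac_weight min_l// powRDn// expn_pred -mulrA.
rewrite invfM mulrA divff ?gt_eqF// mul1r /=.
rewrite invfM exprMn ler_pM ?invr_ge0 ?powR_ge0 ?exprn_ge0//.
  by rewrite -exprVn -exprM mulnC exprM lerXn2r ?nnegrE ?invr_ge0// ltW.
rewrite -pX -powR_inv1 ?powR_ge0// -powRrM mulrC powRrM powR_inv1//.
by rewrite ge0_ler_powR ?nnegrE ?invr_ge0 ?exprn_ge0// ltW.
Qed.

Let far_bound k (h : 'rV[R]_n) : 2 ^+ k <= `|h| -> frac_weight alpha h <= (2 ^+ n * p) ^- k.
Proof.
move=> hk; have h1 : 1 <= `|h| by rewrite (le_trans _ hk)// exprn_ege1// ler1n.
have hp : 0 < `|h| by rewrite (lt_le_trans ltr01).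
rewrite /frac_weight min_r// div1r powRDn// lef_pV2 ?posrE; last 2 first.
- by rewrite mulr_gt0 ?powR_gt0// exprn_gt0.
- by rewrite exprn_gt0// mulr_gt0// exprn_gt0.
rewrite exprMn ler_pM ?exprn_ge0 ?powR_ge0// ?(ltW p_gt0)//.
  by rewrite -exprM mulnC exprM lerXn2r ?nnegrE ?exprn_ge0.
by rewrite -pX ge0_ler_powR ?nnegrE ?exprn_ge0// ltW.
Qed.

(** Each dyadic annulus is enlarged to the full ball that contains it, whose volume is explicit; the
    series of the bounds still converge. *)
Let near k (h : 'rV[R]_n) : \bar R :=
  ((2 ^+ n.-1 * p) ^+ k.+1 * \1_[set x : 'rV[R]_n | `|x| <= 2 ^- k] h)%:E.
Let far k (h : 'rV[R]_n) : \bar R :=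
  ((2 ^+ n * p) ^- k * \1_[set x : 'rV[R]_n | `|x| <= 2 ^+ k.+1] h)%:E.

Local Open Scope ereal_scope.

Let near_ge0 k h : 0 <= near k h.
Proof. by rewrite lee_fin mulr_ge0// exprn_ge0// mulr_ge0 ?exprn_ge0// ltW. Qed.

Let far_ge0 k h : 0 <= far k h.
Proof. by rewrite lee_fin mulr_ge0// invr_ge0 exprn_ge0// mulr_ge0 ?exprn_ge0// ltW. Qed.

Let mnear k : measurable_fun setT (near k).
Proof.
apply/measurable_EFinP; apply: measurable_funM => //.
by apply: measurable_indic; exact: measurable_cball_rV.
Qed.

Let mfar k : measurable_fun setT (far k).
Proof.
apply/measurable_EFinP; apply: measurable_funM => //.
by apply: measurable_indic; exact: measurable_cball_rV.
Qed.

Let int_near k : \int[lebesgue_rV n]_h near k h =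
  ((2 ^+ n * (2 ^+ n.-1 * p)) * (p / 2) ^+ k)%:E.
Proof.
rewrite /near; under eq_integral do rewrite EFinM.
have mB := @measurable_cball_rV R n (2 ^- k).
rewrite ge0_integralZl_EFin//; last 2 first.
- by apply/measurable_EFinP; exact: measurable_indic.
- by rewrite exprn_ge0// mulr_ge0 ?exprn_ge0// ltW.
rewrite integral_indic_cball_rV ?invr_ge0 ?exprn_ge0//.
rewrite -EFinM; congr EFin.
have -> : ((2 / 2 ^+ k) ^+ n = 2 ^+ n * (((2 ^+ n.-1) ^+ k)^-1 * 2^-1 ^+ k) :> R)%R.
  rewrite exprMn; congr (_ * _)%R; rewrite -exprVn -exprM mulnC exprM expn_pred.
  by rewrite mulrC; congr (_ * _)%R; rewrite !exprVn.
rewrite exprS [((2 ^+ n.-1 * p) ^+ k)%R]exprMn [((p / 2) ^+ k)%R]exprMn.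
by apply: cancel_mid; rewrite !expf_neq0.
Qed.

Let int_far k : \int[lebesgue_rV n]_h far k h = (4 ^+ n * (p^-1) ^+ k)%:E.
Proof.
rewrite /far; under eq_integral do rewrite EFinM.
have mB := @measurable_cball_rV R n (2 ^+ k.+1).
rewrite ge0_integralZl_EFin//; last 2 first.
- by apply/measurable_EFinP; exact: measurable_indic.
- by rewrite invr_ge0 exprn_ge0// mulr_ge0 ?exprn_ge0// ltW.
rewrite integral_indic_cball_rV ?exprn_ge0//.
rewrite -EFinM; congr EFin.
have -> : ((2 * 2 ^+ k.+1) ^+ n = 4 ^+ n * (2 ^+ n) ^+ k :> R)%R.
  by rewrite exprS mulrA exprMn -natrM -!exprM mulnC.
by rewrite exprMn invfM exprVn cancel_left// !expf_neq0.
Qed.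

Let le_nneseries (u : nat -> \bar R) k : (forall i, 0 <= u i) ->
  u k <= \sum_(i <oo) u i.
Proof.
move=> u0; rewrite (le_trans _ (@nneseries_lim_ge _ _ xpredT 0 k.+1 (fun i _ _ => u0 i)))//.
by rewrite big_nat_recr//= leeDr// sume_ge0.
Qed.

Lemma integrable_frac_weight_dyadic :
  (lebesgue_rV n).-integrable setT (EFin \o @frac_weight n alpha).
Proof.
have mw := measurable_frac_weight alpha (n := n).
apply/integrableP; split; first exact/measurable_EFinP.
pose S h := \sum_(k <oo) near k h + \sum_(k <oo) far k h.
(* The sum [S] dominates the weight: a nonzero [h] lies in some annulus, where a single term of one
   series suffices, and all other terms are nonnegative. *)
have mS1 : measurable_fun setT (fun h => \sum_(k <oo) near k h).
  exact: ge0_emeasurable_sum.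
have mS2 : measurable_fun setT (fun h => \sum_(k <oo) far k h).
  exact: ge0_emeasurable_sum.
have S1_ge0 h : 0 <= \sum_(k <oo) near k h by exact: nneseries_ge0.
have S2_ge0 h : 0 <= \sum_(k <oo) far k h by exact: nneseries_ge0.
apply: (@le_lt_trans _ _ (\int[lebesgue_rV n]_h S h)).
  apply: ge0_le_integral => //.
  - by apply: measurableT_comp => //; exact/measurable_EFinP.
  - exact: emeasurable_funD.
  - move=> h _; rewrite /= ger0_norm ?frac_weight_ge0//.
    have [h0|h0] := eqVneq h 0%R.
      by rewrite h0 /frac_weight normr0 min_l// mul0r adde_ge0.
    have hp : (0 < `|h|)%R by rewrite normr_gt0.
    have [h1|h1] := leP (`|h|)%R 1%R.
      have /exists_dyadic[k hk] : (1 <= `|h|^-1)%R by rewrite invf_ge1.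
      rewrite (@le_trans _ _ (near k h))//.
        rewrite lee_fin indicE mem_set ?mulr1; first exact: near_bound.
        by rewrite /= -[leLHS]invrK lef_pV2 ?posrE ?invr_gt0 ?exprn_gt0//; case/andP: hk.
      by rewrite (le_trans (le_nneseries k (near_ge0^~ h)))// leeDl.
    have /exists_dyadic[k /andP[hk1 hk2]] := ltW h1.
    rewrite (@le_trans _ _ (far k h))//.
      by rewrite lee_fin indicE mem_set ?mulr1/=; [exact: far_bound|exact: ltW].
    by rewrite (le_trans (le_nneseries k (far_ge0^~ h)))// leeDr.
rewrite ge0_integralD// !integral_nneseries//.
under eq_eseriesr do rewrite int_near.
under [X in _ + X]eq_eseriesr do rewrite int_far.
rewrite lte_add_pinfty//; apply: nneseries_geometric_lty.
- by rewrite !mulr_ge0 ?exprn_ge0// ltW.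
- by rewrite divr_ge0 ?ltW//= ltr_pdivrMr// mul1r.
- by rewrite exprn_ge0.
- by rewrite invr_ge0 ltW//= invf_lt1.
Qed.

End dyadic_bound.

Lemma integrable_frac_weight n (alpha : R) : (0 < n)%N -> (0 < alpha < 1)%R ->
  (lebesgue_rV n).-integrable setT (EFin \o @frac_weight n alpha).
Proof.
move=> n0 /andP[a0 a1].
have ln2 : (0 < ln (2 : R))%R by rewrite ln_gt0// ltr1n.
have powR2 : (2 `^ alpha = expR (alpha * ln 2) :> R)%R by rewrite /powR pnatr_eq0.
(* With p = 2^alpha, alpha < 1 gives p < 2 (convergence at the origin) and alpha > 0 gives p > 1
   (convergence at infinity). *)
apply: (@integrable_frac_weight_dyadic n alpha (2 `^ alpha)) => //.
- by rewrite powR2 expR_gt1 mulr_gt0.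
- rewrite powR2 -[ltRHS]lnK ?posrE// ltr_expR -[ltRHS]mul1r ltr_pM2r//.
- move=> k; rewrite -(powR_mulrn k (ler0n R 2)) -(powR_mulrn k (powR_ge0 2 alpha)).
  by rewrite -!powRrM mulrC.
Qed.

End singular_kernel.

(** * Mollifiers *)

Section directional_derivatives.
Context {R : realType} {n : nat}.
Implicit Types (x y v : 'rV[R]_n) (V : normedModType R).

Let line_quotient V (g : 'rV[R]_n -> V) x v (t : R) :
  (fun h : R => h^-1 *: (((fun s => g (s *: v + x)) \o shift t) (h *: 1) -
     (fun s => g (s *: v + x)) t)) =
  (fun h : R => h^-1 *: ((g \o shift (t *: v + x)) (h *: v) - g (t *: v + x))).
Proof.
apply/funext => h; congr (_ *: (_ - _)) => /=; congr g.
by rewrite addrA -scalerDl; congr (_ *: _ + _); rewrite /GRing.scale/= mulr1.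
Qed.

(** Reduces a directional derivative to one real variable, where the mean value theorem, the chain
    rule and differentiation under the integral are available. *)
Lemma is_derive_lineP V (g : 'rV[R]_n -> V) x v (t : R) l :
  is_derive (t *: v + x) v g l <-> is_derive t 1 (fun s => g (s *: v + x)) l.
Proof.
split => -[d1 d2]; apply: DeriveDef.
- by rewrite /derivable line_quotient.
- by rewrite -d2 /derive line_quotient.
- by rewrite /derivable -line_quotient.
- by rewrite -d2 /derive -line_quotient.
Qed.

Lemma is_derive_line0 V (g : 'rV[R]_n -> V) x v l :
  is_derive (0 : R) 1 (fun s => g (s *: v + x)) l -> is_derive x v g l.
Proof. by move=> /is_derive_lineP; rewrite scale0r add0r. Qed.

Lemma directional_increment_le (g : 'rV[R]_n -> R) v (M : R) x (t : R) :
  (forall z, derivable g z v) -> (forall z, `|'D_v g z| <= M) ->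
  `|g (t *: v + x) - g x| <= M * `|t|.
Proof.
move=> dg gM; pose k s := g (s *: v + x).
have dk (s : R) : is_derive s 1 k ('D_v g (s *: v + x)).
  by apply/is_derive_lineP; exact: derivableP.
have ck : continuous k.
  by move=> s; apply/differentiable_continuous/derivable1_diffP; case: (dk s).
have -> : g x = k 0 by rewrite /k scale0r add0r.
rewrite -[g _]/(k t).
have [t0|t0] := leP 0 t.
- have [c _ ->] := MVT_segment t0 (fun s _ => dk s) (continuous_subspaceT ck).
  by rewrite subr0 normrM ler_wpM2r.
- have [c _] := MVT_segment (ltW t0) (fun s _ => dk s) (continuous_subspaceT ck).
  rewrite distrC => ->.
  by rewrite sub0r normrM normrN ler_wpM2r.
Qed.

(** The coordinates of [x] are replaced with those of [y] one at a time; each of the n replacements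
    costs at most [M * |x - y|]. *)
Lemma bounded_partials_lipschitz (g : 'rV[R]_n -> R) (M : R) :
  (forall i z, derivable g z (evec i)) -> (forall i z, `|'D_(evec i) g z| <= M) ->
  forall x y, `|g x - g y| <= n%:R * M * `|x - y|.
Proof.
move=> dg gM x y.
pose z k := \row_(j < n) (if (j < k)%N then y ord0 j else x ord0 j).
suff H k : (k <= n)%N -> `|g x - g (z k)| <= k%:R * M * `|x - y|.
  have zn : z n = y by apply/rowP => j; rewrite mxE ltn_ord.
  by rewrite -{1}zn; exact: H.
elim: k => [_|k IH kn].
  rewrite !mul0r (_ : z 0%N = x) ?subrr ?normr0//.
  by apply/rowP => j; rewrite mxE.
pose i := Ordinal kn.
have zE : z k.+1 = (y ord0 i - x ord0 i) *: (evec i : 'rV[R]_n) + z k.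
  apply/rowP => j; rewrite !mxE eqxx/= ltnS leq_eqVlt -val_eqE/=.
  have [jk|jk] := eqVneq (nat_of_ord j) k; last by rewrite mulr0 add0r.
  have -> : j = i by apply: val_inj.
  by rewrite /= ltnn mulr1 subrK.
rewrite (le_trans (ler_distD (g (z k)) _ _))//.
rewrite -natr1 !mulrDl mul1r lerD//; first exact/IH/ltnW.
rewrite distrC zE (le_trans (directional_increment_le _ _ (dg i) (gM i)))//.
rewrite ler_wpM2l//; first by rewrite (le_trans (normr_ge0 _) (gM i 0)).
by rewrite distrC; have := ler_coord_norm (x - y) i; rewrite !mxE.
Qed.

Lemma lipschitz_continuous_rV (V : normedModType R) (g : 'rV[R]_n -> V) (K : R) :
  (forall x y, `|g x - g y| <= K * `|x - y|) -> continuous g.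
Proof.
move=> gK x; apply/(@cvgrPdist_le _ _ _ (nbhs x) _ g (g x)) => e e0 /=.
near=> y; rewrite (le_trans (gK _ _))//.
rewrite (@le_trans _ _ ((`|K| + 1) * `|x - y|))//.
  by rewrite ler_wpM2r// (le_trans (ler_norm _))// lerDl.
rewrite mulrC -ler_pdivlMr//; near: y.
by apply: (@cvgr_dist_le _ _ _ (nbhs x) _ id x cvg_id); rewrite divr_gt0.
Unshelve. all: by end_near. Qed.

End directional_derivatives.

(** * One-dimensional bump functions *)

Section bump.
Context {R : realType}.
Variable r : R.
Hypothesis r_gt0 : 0 < r.
Implicit Types (Q : {poly R}) (P : {poly R} * nat) (t : R).

(* The functions Q(t) u^m exp(-u) with u = 1/(r^2 - t^2), extended by zero, are
   stable under derivation. *)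
Definition bump P t : R :=
  if `|t| < r then P.1.[t] * ((r ^+ 2 - t ^+ 2)^-1) ^+ P.2 * expR (- (r ^+ 2 - t ^+ 2)^-1)
  else 0.

(** With W = 1/u one has u' = 2 t u^2, hence (Q u^m exp(-u))' = (Q' + 2 m t Q u - 2 t Q u^2) u^m
    exp(-u). Taking out u^2 turns the bracket into the polynomial Q' W^2 + 2 m t Q W - 2 t Q and
    raises the exponent to m + 2. *)
Definition bump_deriv P : {poly R} * nat :=
  let W := (r ^+ 2)%:P - 'X^2 in
  (P.1^`() * W ^+ 2 + (2 * P.2%:R) *: ('X * P.1 * W) - 2 *: ('X * P.1), P.2.+2).

Let u t := (r ^+ 2 - t ^+ 2)^-1.

Let w_gt0 t : `|t| < r -> 0 < r ^+ 2 - t ^+ 2.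
Proof. by move=> tr; rewrite subr_gt0 -(real_normK (num_real t)) ltrXn2r// ?nnegrE ltW. Qed.

Let horner_bounded Q : exists2 C : R, 0 <= C & forall t, `|t| < r -> `|Q.[t]| <= C.
Proof.
exists (\sum_(i < size Q) `|Q`_i| * r ^+ i).
  by apply: sumr_ge0 => i _; rewrite mulr_ge0// exprn_ge0// ltW.
move=> t tr; rewrite horner_coef (le_trans (ler_norm_sum _ _ _))//.
apply: ler_sum => i _; rewrite normrM normrX ler_wpM2l//.
by rewrite lerXn2r ?nnegrE// ltW.
Qed.

(* Quadratic vanishing as |t| tends to r, which gives the derivative at |t| = r. *)
Lemma bump_bound P : exists2 C : R, 0 <= C &
  forall t, `|t| < r -> `|bump P t| <= C * (r ^+ 2 - t ^+ 2) ^+ 2.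
Proof.
have [C C0 QC] := horner_bounded P.1; set m := P.2.
exists (C * m.+2`!%:R); first by rewrite mulr_ge0.
move=> t tr; have w0 := w_gt0 tr; rewrite /bump tr.
have u0 : 0 < u t by rewrite invr_gt0.
rewrite !normrM -!mulrA ler_pM ?mulr_ge0//; first exact: QC.
rewrite -/(u t) -/m (ger0_norm (exprn_ge0 _ (ltW u0))) (ger0_norm (expR_ge0 _)).
(* Keeping only the term of degree m + 2 of the exponential series gives u^m exp(-u) <= (m + 2)!
   u^-2, the source of the factorial. *)
have H : u t ^+ m * u t ^+ 2 / m.+2`!%:R <= expR (u t).
  by rewrite -exprD addn2 (le_trans _ (expR_ge1Dxn m.+1 (ltW u0)))// lerDr.
have -> : r ^+ 2 - t ^+ 2 = (u t)^-1 by rewrite invrK.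
rewrite expRN ler_pdivrMr ?expR_gt0// [(u t)^-1 ^+ 2]exprVn mulrAC ler_pdivlMr ?exprn_gt0//.
by rewrite [leRHS]mulrC -ler_pdivrMr ?ltr0n ?fact_gt0.
Qed.

Lemma bump_bounded P : exists2 C : R, 0 <= C & forall t, `|bump P t| <= C.
Proof.
have [C C0 H] := bump_bound P; exists (C * (r ^+ 2) ^+ 2).
  by rewrite mulr_ge0// exprn_ge0// sqr_ge0.
move=> t; have [tr|tr] := ltP `|t| r; last first.
  by rewrite /bump ltNge tr/= normr0 mulr_ge0// exprn_ge0// sqr_ge0.
rewrite (le_trans (H _ tr))// ler_wpM2l// lerXn2r ?nnegrE ?sqr_ge0//.
  by rewrite ltW// w_gt0.
by rewrite lerBlDr lerDl sqr_ge0.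
Qed.

Let is_derive_quadratic (g : R -> R) t (K : R) :
  (forall s, `|s - t| <= 1 -> `|g s - g t| <= K * (s - t) ^+ 2) -> is_derive t 1 g 0.
Proof.
move=> gK.
have K0 : 0 <= K.
  by have := gK (t + 1); rewrite addrAC subrr add0r normr1 expr1n mulr1 => /(_ (lexx _)); apply: le_trans.
suff H : (fun h => h^-1 *: ((g \o shift t) (h *: 1) - g t)) @ 0^' --> (0 : R).
  apply: DeriveDef; last exact/cvg_lim.
  by apply/cvg_ex; exists 0.
apply/cvgrPdist_le => e e0 /=; near=> h.
have h0 : h != 0 by near: h; exact: nbhs_dnbhs_neq.
have h1 : `|h| <= Num.min 1 (e / (K + 1)).
  near: h; apply: dnbhs0_le; rewrite lt_min ltr01/= divr_gt0//.
  by rewrite ltr_wpDl.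
move: h1; rewrite le_min => /andP[h1 he].
rewrite sub0r normrN normrM normfV /GRing.scale/= mulr1.
have := gK (h + t); rewrite addrK => /(_ h1) gh.
rewrite ler_pdivrMl ?normr_gt0// (le_trans gh)//.
rewrite -(real_normK (num_real h)) expr2 mulrCA ler_wpM2l//.
rewrite (@le_trans _ _ ((K + 1) * `|h|))//.
  by rewrite ler_wpM2r// lerDl.
by rewrite mulrC -ler_pdivlMr// ltr_wpDl.
Unshelve. all: by end_near. Qed.

(** [Um1] stands for the power of exponent m - 1, truncated at 0; its relation to [Um] is multiplied
    by m so that it also holds for m = 0. *)
Let bump_deriv_identity (q q' U Um m Um1 w E t : R) : w * U = 1 -> m * Um1 * U = m * Um ->
  (q * Um) * (E * - (2 * t * U ^+ 2)) + E * (q * (m * Um1 * (2 * t * U ^+ 2)) + Um * q') =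
  (q' * w ^+ 2 + 2 * m * (t * q * w) - 2 * (t * q)) * (Um * U ^+ 2) * E.
Proof.
move=> wU mU.
have -> : (q' * w ^+ 2 + 2 * m * (t * q * w) - 2 * (t * q)) * (Um * U ^+ 2) * E =
  q' * Um * E * (w * U) ^+ 2 + 2 * m * t * q * Um * E * U * (w * U)
  - 2 * t * q * Um * U ^+ 2 * E by lra.
have -> : (q * Um) * (E * - (2 * t * U ^+ 2)) +
   E * (q * (m * Um1 * (2 * t * U ^+ 2)) + Um * q') =
  - (2 * t * q * Um * U ^+ 2 * E) + q * E * 2 * t * U * (m * Um1 * U) + E * Um * q'
  by lra.
by rewrite mU wU; lra.
Qed.

Lemma is_derive_bump P t : is_derive t 1 (bump P) (bump (bump_deriv P) t).
Proof.
have [tr|tr] := ltP `|t| r; last first.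
  have bt (P' : {poly R} * nat) : bump P' t = 0 by rewrite /bump ltNge tr.
  have [C C0 CP] := bump_bound P.
  (* For r <= |t| and |s - t| <= 1, r^2 - s^2 <= t^2 - s^2 = (t - s)(t + s) and |t + s| <= 2|t| + 1.
     Squaring this in [bump_bound] gives the constant. *)
  rewrite bt; apply: (@is_derive_quadratic _ _ (C * (2 * `|t| + 1) ^+ 2)) => s st.
  rewrite bt subr0; have [sr|sr] := ltP `|s| r; last first.
    by rewrite /bump ltNge sr/= normr0 mulr_ge0 ?sqr_ge0// mulr_ge0 ?sqr_ge0.
  rewrite (le_trans (CP _ sr))// -mulrA ler_wpM2l//.
  have ws := w_gt0 sr.
  have : r ^+ 2 - s ^+ 2 <= (2 * `|t| + 1) * `|s - t|.
    have rt : r ^+ 2 <= t ^+ 2.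
      by rewrite -(real_normK (num_real t)) lerXn2r// ?nnegrE ltW.
    rewrite (@le_trans _ _ (t ^+ 2 - s ^+ 2))// ?lerD2r//.
    rewrite (le_trans (ler_norm _))// subr_sqr normrM mulrC distrC ler_wpM2r//.
    rewrite (_ : t + s = 2 * t + (s - t)); last by lra.
    by rewrite (le_trans (ler_normD _ _))// normrM ger0_norm// lerD2l.
  move=> H; rewrite -(real_normK (num_real (s - t))) -exprMn.
  by rewrite lerXn2r ?nnegrE ?(ltW ws)// mulr_ge0// addr_ge0// mulr_ge0.
have w0 := w_gt0 tr.
set W := (r ^+ 2)%:P - 'X^2.
have WE s : W.[s] = r ^+ 2 - s ^+ 2 by rewrite /W !hornerE.
have dw : is_derive t 1 (horner W) (- (2 * t)).
  apply: is_derive_eq; rewrite /W derivB derivC derivXn sub0r hornerN.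
  by rewrite hornerMn hornerXn mulr_natl expr1.
have uE : u = fun s => (W.[s])^-1 by apply/funext => s; rewrite WE.
have du : is_derive t 1 u (2 * t * u t ^+ 2).
  have W0 : W.[t] != 0 by rewrite WE gt_eqF.
  have := is_deriveV W0 dw; rewrite -uE => H.
  by apply: is_derive_eq H _; rewrite uE /GRing.scale/= mulrNN mulrC exprVn.
have de : is_derive t 1 (expR \o (- u)) (expR (- u t) * (- (2 * t * u t ^+ 2))).
  by apply: is_derive1_comp.
have dp : is_derive t 1 (horner P.1 * (u ^+ P.2) * (expR \o (- u)))
  (bump (bump_deriv P) t).
  apply: is_derive_eq; rewrite /bump tr /bump_deriv -/W -/(u t)/=.
  rewrite /W !(hornerD, hornerN, hornerZ, hornerM, hornerX, horner_exp, hornerC).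
  have -> : u t ^+ P.2.+2 = u t ^+ P.2 * u t ^+ 2 by rewrite -exprD addn2.
  rewrite /GRing.scale/= !fctE -[t * t]expr2 -[(_ - _) * (_ - _)]expr2.
  apply: bump_deriv_identity; first by rewrite mulfV// gt_eqF.
  by case: P.2 => [|m]; rewrite ?mul0r// -mulrA -exprSr.
apply: near_eq_is_derive dp; near=> s; rewrite /bump ifT; first by rewrite !fctE.
near: s; exact: (@cvgr_norm_lt _ _ _ (nbhs t) _ id t cvg_id _ tr).
Unshelve. all: by end_near. Qed.

Lemma bump_even t : bump (1, 0%N) (- t) = bump (1, 0%N) t.
Proof. by rewrite /bump normrN sqrrN !hornerE. Qed.

Lemma bump_ge0 t : 0 <= bump (1, 0%N) t.
Proof. by rewrite /bump; case: ifP => // _; rewrite /= hornerC expr0 mul1r mul1r expR_ge0. Qed.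

Lemma bump_gt0 t : `|t| < r -> 0 < bump (1, 0%N) t.
Proof. by move=> tr; rewrite /bump tr /= hornerC expr0 mul1r mul1r expR_gt0. Qed.

Lemma bump_out P t : r <= `|t| -> bump P t = 0.
Proof. by move=> tr; rewrite /bump ltNge tr. Qed.

End bump.

(** * Bump functions of several variables *)

Section product_bump.
Context {R : realType} {n : nat}.
Variable r : R.
Hypothesis r_gt0 : 0 < r.
Implicit Types (P : 'I_n -> {poly R} * nat) (x y v : 'rV[R]_n) (i : 'I_n).

(** A product over coordinates instead of a radial function: partial derivatives then reduce to one
    variable, and the support lies in a ball of the sup norm. *)
Definition prod_bump P x : R := \prod_(j < n) bump r (P j) (x ord0 j).

Definition prod_bump_deriv P i : 'I_n -> {poly R} * nat :=
  fun j => if j == i then bump_deriv r (P j) else P j.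

(** Along [evec i] only the factor of index i varies, so the family indexed by [P] is closed under
    partial derivatives. *)
Lemma is_derive_prod_bump P i x :
  is_derive x (evec i) (prod_bump P) (prod_bump (prod_bump_deriv P i) x).
Proof.
pose c := \prod_(j < n | j != i) bump r (P j) (x ord0 j).
have db : is_derive (0 + x ord0 i) 1 (bump r (P i))
    (bump r (bump_deriv r (P i)) (x ord0 i)).
  by rewrite add0r; exact: is_derive_bump.
have lineE : (fun s : R => prod_bump P (s *: (evec i : 'rV[R]_n) + x)) =
    (fun s => c *: bump r (P i) (s + x ord0 i)).
  apply/funext => s; rewrite /prod_bump (bigD1 i)//= mulrC; congr (_ * _).
    apply: eq_bigr => j ji; rewrite !mxE eqxx/= (negbTE ji) mulr0 add0r//.
  by rewrite !mxE !eqxx mulr1.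
apply: is_derive_line0; rewrite lineE.
have -> : prod_bump (prod_bump_deriv P i) x = c *: bump r (bump_deriv r (P i)) (x ord0 i).
  rewrite /prod_bump (bigD1 i)//= mulrC /prod_bump_deriv eqxx; congr (_ * _).
  by apply: eq_bigr => j /negbTE ->.
apply: is_deriveZ.
have dS : is_derive (0 : R) 1 (fun s : R => s + x ord0 i) 1.
  have := is_deriveD (is_derive_id (0 : R) 1) (is_derive_cst (x ord0 i) (0 : R) 1).
  by move=> /is_derive_eq; apply; rewrite addr0.
have := @is_derive1_comp _ (bump r (P i)) (fun s : R => s + x ord0 i) 0 _ _ db dS.
by rewrite mulr1.
Qed.

Lemma prod_bump_bounded P : exists2 C : R, 0 <= C & forall x, `|prod_bump P x| <= C.
Proof.
have /choice[C HC] : forall j, exists C : R, 0 <= C /\ forall t, `|bump r (P j) t| <= C.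
  by move=> j; have [C C0 H] := bump_bounded r_gt0 (P j); exists C.
exists (\prod_(j < n) C j); first by apply: prodr_ge0 => j _; have [] := HC j.
move=> x; rewrite /prod_bump normr_prod; apply: ler_prod => j _.
by rewrite normr_ge0; have [_ ->] := HC j.
Qed.

Lemma prod_bump_lipschitz P : exists2 K : R, 0 <= K &
  forall x y, `|prod_bump P x - prod_bump P y| <= K * `|x - y|.
Proof.
have /choice[C HC] : forall i, exists C : R, 0 <= C /\
    forall x, `|prod_bump (prod_bump_deriv P i) x| <= C.
  by move=> i; have [C C0 H] := prod_bump_bounded (prod_bump_deriv P i); exists C.
have C0 : 0 <= \sum_i C i by apply: sumr_ge0 => i _; have [] := HC i.
exists (n%:R * \sum_i C i); first by rewrite mulr_ge0.
apply: bounded_partials_lipschitz => i z; have [d1 d2] := is_derive_prod_bump P i z => //.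
rewrite d2 (bigD1 i)//= (@le_trans _ _ (C i)) ?lerDl//; first by have [_ ->] := HC i.
by apply: sumr_ge0 => j _; have [] := HC j.
Qed.

Lemma continuous_prod_bump P : continuous (prod_bump P).
Proof.
have [K _ H] := prod_bump_lipschitz P; exact: lipschitz_continuous_rV H.
Qed.

Lemma measurable_prod_bump P : measurable_fun setT (prod_bump P).
Proof. by apply: continuous_measurable_rV; exact: continuous_prod_bump. Qed.

Lemma prod_bump_out P x : r <= `|x| -> prod_bump P x = 0.
Proof.
move=> rx; have [i xi] : exists i, r <= `|x ord0 i|.
  apply: contrapT => /forallNP H; move: rx; apply/negP; rewrite -ltNge.
  by apply: normr_rV_lt => // i; rewrite ltNge; apply/negP/H.
by rewrite /prod_bump (bigD1 i)//= bump_out// mul0r.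
Qed.

Local Notation std := (fun _ : 'I_n => (1 : {poly R}, 0%N)).

Lemma prod_bump_std_even x : prod_bump std (- x) = prod_bump std x.
Proof. by apply: eq_bigr => j _; rewrite mxE bump_even. Qed.

Lemma prod_bump_std_ge0 x : 0 <= prod_bump std x.
Proof. by apply: prodr_ge0 => j _; exact: bump_ge0. Qed.

Lemma prod_bump_std_gt0 x : `|x| < r -> 0 < prod_bump std x.
Proof.
move=> xr; apply: prodr_gt0 => j _; apply: bump_gt0 => //.
exact: le_lt_trans (ler_coord_norm _ _) xr.
Qed.

Lemma prod_bump_integrable P :
  (lebesgue_rV n).-integrable setT (EFin \o prod_bump P).
Proof.
have [C C0 HC] := prod_bump_bounded P.
have mB := @measurable_cball_rV R n r.
apply: (@le_integrable _ _ _ _ _ measurableT _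
    (fun x => (C * \1_[set x : 'rV[R]_n | `|x| <= r] x)%:E)) => //.
- by apply/measurable_EFinP; exact: measurable_prod_bump.
- move=> x _; rewrite lee_fin indicE; have [|xr] := boolP (x \in _).
    by rewrite mulr1 (le_trans (HC x))// ler_norm.
  rewrite prod_bump_out ?normr0//; rewrite leNgt; apply/negP => /ltW rx.
  by move: xr; rewrite mem_set.
- under eq_fun do rewrite EFinM; apply: integrableZl => //.
  by apply: l1_indic => //; exact: lebesgue_rV_cball_lty.
Qed.

End product_bump.

(** * Convolution with bumps and existence of mollifiers *)

Section convolution.
Context {R : realType} {n : nat}.
Notation leb := (@lebesgue_rV R n).
Notation "f \in_L1" := (leb.-integrable [set: 'rV[R]_n] (EFin \o f)) (at level 10).
Implicit Types (f g k : 'rV[R]_n -> R) (x y h : 'rV[R]_n).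

Definition conv f g x : R := \int[leb]_y (f y * g (x - y)).

Lemma integrableM_bounded f g (C : R) : f \in_L1 -> measurable_fun setT g ->
  (forall x, `|g x| <= C) -> (fun x => f x * g x) \in_L1.
Proof.
move=> fL1 mg gC.
apply: (@le_integrable _ _ _ _ _ measurableT _ (fun x => C%:E * (`|f x|)%:E)%E) => //.
- by apply/measurable_EFinP; apply: measurable_funM => //; exact: measurable_l1 fL1.
- move=> x _; rewrite /= lee_fin !normrM normr_id mulrC ler_wpM2r//.
  by rewrite (le_trans (gC x))// ler_norm.
- by apply: integrableZl => //; exact: integrable_norm.
Qed.

Lemma measurable_subl x : measurable_fun setT (fun y : 'rV[R]_n => x - y).
Proof. by apply: measurable_rVB. Qed.

Lemma conv_integrable f g (C : R) x : f \in_L1 -> measurable_fun setT g ->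
  (forall z, `|g z| <= C) -> (fun y => f y * g (x - y)) \in_L1.
Proof.
move=> fL1 mg gC; apply: (@integrableM_bounded _ _ C) => //.
by apply: (measurableT_comp mg); exact: measurable_subl.
Qed.

Lemma conv_bounded f g (C : R) x : 0 <= C -> f \in_L1 -> measurable_fun setT g ->
  (forall z, `|g z| <= C) -> `|conv f g x| <= C * \int[leb]_y `|f y|.
Proof.
move=> C0 fL1 mg gC; have cL1 := conv_integrable x fL1 mg gC.
rewrite (le_trans (le_normr_Rintegral _ cL1))// -RintegralZl//; last exact: integrable_norm.
apply: le_Rintegral => //.
- exact: integrable_norm cL1.
- by rewrite /comp; under eq_fun do rewrite EFinM; apply: integrableZl => //; exact: integrable_norm.
- by move=> y _; rewrite normrM mulrC ler_wpM2r.
Qed.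

Section conv_prod_bump.
Variables (r : R) (f : 'rV[R]_n -> R).
Hypotheses (r_gt0 : 0 < r) (fL1 : f \in_L1).
Implicit Types P : 'I_n -> {poly R} * nat.

Lemma is_derive_conv_bump P i x :
  is_derive x (evec i) (conv f (prod_bump r P))
    (conv f (prod_bump r (prod_bump_deriv r P i)) x).
Proof.
set P' := prod_bump_deriv r P i; set e : 'rV[R]_n := evec i.
have [C C0 HC] := prod_bump_bounded r_gt0 P.
have [C' C'0 HC'] := prod_bump_bounded r_gt0 P'.
pose F (s : R) y := f y * prod_bump r P (s *: e + x - y).
have dF (s : R) y : is_derive s 1 (F ^~ y) (f y * prod_bump r P' (s *: e + x - y)).
  have := is_derive_prod_bump r_gt0 P i (s *: e + (x - y)).
  rewrite is_derive_lineP => /(is_deriveZ (f y)).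
  rewrite addrA (_ : _ \*: _ = F ^~ y)//.
  by apply/funext => t; rewrite /F -addrA.
have d1F (s : R) y : partial1of2 F s y = f y * prod_bump r P' (s *: e + x - y).
  by rewrite partial1of2E; have [_ ->] := dF s y.
have iF (s : R) : leb.-integrable setT (EFin \o F s).
  exact: (conv_integrable (s *: e + x) fL1 (measurable_prod_bump r_gt0 P) HC).
pose G y := C' * `|f y|.
have G0 y : 0 <= G y by rewrite mulr_ge0.
have iG : leb.-integrable setT (EFin \o G).
  by rewrite /comp; under eq_fun do rewrite EFinM; apply: integrableZl => //; exact: integrable_norm.
have I0 : [set` `](-1), 1[] (0 : R) by rewrite /= in_itv/= ltrN10 ltr01.
have der (s : R) y : [set` `](-1), 1[] s -> setT y -> derivable (F ^~ y) s 1.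
  by move=> _ _; case: (dF s y).
have FG (s : R) y : [set` `](-1), 1[] s -> setT y -> `|partial1of2 F s y| <= G y.
  by move=> _ _; rewrite d1F normrM mulrC ler_wpM2r.
have iF' (s : R) : [set` `](-1), 1[] s -> leb.-integrable setT (EFin \o F s) by [].
have D1 := derivable_under_integral measurableT I0 iF' der G0 iG FG.
have D2 := differentiation_under_integral measurableT I0 iF' der G0 iG FG.
apply: is_derive_line0; apply: DeriveDef; first exact: D1.
rewrite -derive1E D2; apply: eq_Rintegral => y _.
by rewrite d1F scale0r add0r.
Qed.

(** The partial derivatives are convolutions of [f] with bounded bumps, hence bounded by a multiple
    of the L^1 norm of [f]; the convolution is therefore Lipschitz. *)
Lemma continuous_conv_bump P : continuous (conv f (prod_bump r P)).
Proof.
have /choice[C HC] : forall i, exists C : R, 0 <= C /\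
    forall x, `|prod_bump r (prod_bump_deriv r P i) x| <= C.
  by move=> i; have [C C0 H] := prod_bump_bounded r_gt0 (prod_bump_deriv r P i); exists C.
have I0 : 0 <= \int[leb]_y `|f y| by apply: Rintegral_ge0.
pose M := \sum_i (C i * \int[leb]_y `|f y|).
apply: (@lipschitz_continuous_rV _ _ _ _ (n%:R * M)).
apply: bounded_partials_lipschitz => i z; have [d1 d2] := is_derive_conv_bump P i z => //.
have [C0 Cle] := HC i.
rewrite d2 (le_trans (conv_bounded z C0 fL1 (measurable_prod_bump r_gt0 _) Cle))//.
rewrite /M (bigD1 i)//= lerDl; apply: sumr_ge0 => j _; rewrite mulr_ge0//.
by have [] := HC j.
Qed.

Lemma smooth_conv_bump P : smooth (conv f (prod_bump r P)).
Proof.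
move=> s; elim: s P => [|i s IH] P /=.
  split; first exact: continuous_conv_bump.
  by move=> i x; have [] := is_derive_conv_bump P i x.
rewrite (_ : 'D__ _ = conv f (prod_bump r (prod_bump_deriv r P i))); first exact: IH.
by apply/funext => x; have [_ ->] := is_derive_conv_bump P i x.
Qed.

End conv_prod_bump.

(** Smoothness is recorded through its effect on L^1 functions, the form in which it serves both for
    [f] and for the components of a test field. *)
Record mollifier (r : R) k : Prop := Mollifier {
  mollifier_bounded : exists C, forall x, `|k x| <= C;
  measurable_mollifier : measurable_fun setT k;
  mollifier_ge0 : forall x, 0 <= k x;
  mollifier_even : forall x, k (- x) = k x;
  mollifier_out : forall x, r <= `|x| -> k x = 0;
  mollifier_L1 : k \in_L1;
  mollifier_int : \int[leb]_x k x = 1;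
  mollifier_smooth : forall f, f \in_L1 -> smooth (conv f k) }.

Lemma exists_mollifier (r : R) : 0 < r -> exists k, mollifier r k.
Proof.
move=> r0; pose rho : 'rV[R]_n -> R := prod_bump r (fun=> (1, 0%N)).
have rhoL1 : rho \in_L1 by exact: prod_bump_integrable.
have [C C0 rhoC] := prod_bump_bounded r0 (fun _ : 'I_n => (1 : {poly R}, 0%N)).
have mrho : measurable_fun setT rho by exact: measurable_prod_bump.
have rho0 x : 0 <= rho x by exact: prod_bump_std_ge0.
pose c := \int[leb]_x rho x.
have cE : (c%:E = \int[leb]_x (rho x)%:E)%E.
  by rewrite /c /Rintegral fineK//; exact: integrable_fin_num.
(* A zero integral would make [rho] vanish almost everywhere, but it is positive on the cube |x| <=
   r / 2, of volume r^n > 0. *)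
have c0 : 0 < c.
  rewrite lt_neqAle Rintegral_ge0// andbT; apply/negP => /eqP c0.
  have : (\int[leb]_x `|(rho x)%:E| = 0)%E.
    by under eq_integral do rewrite gee0_abs ?lee_fin//; rewrite -cE -c0.
  move/(ae_eq_integral_abs leb measurableT ((measurable_EFinP _ _).2 mrho)).1.
  move=> [N [mN N0 sN]].
  have : (lebesgue_rV n [set x : 'rV[R]_n | (`|x| <= r / 2)%R] <= leb N)%E.
    apply: le_measure; rewrite ?inE//; first exact: measurable_cball_rV.
    move=> x /= xr; apply: sN => /= /(_ I)[] rx0.
    have : 0 < rho x.
      by apply: prod_bump_std_gt0 => //; rewrite (le_lt_trans xr)// ltr_pdivrMr// ltr_pMr// ltr1n.
    by rewrite rx0 ltxx.
  by rewrite N0 lebesgue_rV_cball ?divr_ge0 ?(ltW r0)// lee_fin leNgt exprn_gt0// mulr_gt0// divr_gt0.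
exists (fun x => c^-1 * rho x); split.
- by exists (c^-1 * C) => x; rewrite normrM ger0_norm ?invr_ge0 ?ler_wpM2l ?invr_ge0// ltW.
- exact: measurable_funM.
- by move=> x; rewrite mulr_ge0// invr_ge0 ltW.
- by move=> x; rewrite /rho prod_bump_std_even.
- by move=> x rx; rewrite /rho prod_bump_out// mulr0.
- by rewrite /comp; under eq_fun do rewrite EFinM; exact: integrableZl.
- by rewrite RintegralZl// mulVf// gt_eqF.
(* The normalising factor is moved onto [f], which leaves the convolution with an unnormalised
   product bump. *)
- move=> f fL1; rewrite (_ : conv _ _ = conv (fun y => c^-1 * f y) rho).
    apply: smooth_conv_bump => //.
    by rewrite /comp; under eq_fun do rewrite EFinM; exact: integrableZl.
  by apply/funext => x; apply: eq_Rintegral => y _; rewrite mulrCA mulrA.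
Qed.

End convolution.

(** * Smooth compactly supported fields *)

Section vector_fields.
Context {R : realType} {n : nat}.
Notation leb := (@lebesgue_rV R n).
Notation "f \in_L1" := (leb.-integrable [set: 'rV[R]_n] (EFin \o f)) (at level 10).
Implicit Types (x y h : 'rV[R]_n) (phi : 'rV[R]_n -> 'rV[R]_n).

Lemma continuous_row (G : 'I_n -> 'rV[R]_n -> R) : (forall j, continuous (G j)) ->
  continuous (fun x => \row_j G j x : 'rV[R]_n).
Proof.
move=> cG x; apply/(@cvgrPdist_le _ _ _ (nbhs x) _ (fun x => \row_j G j x : 'rV[R]_n)) => e e0 /=.
near=> y; apply: normr_rV_le; first exact: ltW.
move=> j; rewrite !mxE; move: j; near: y; apply: filter_forall => j.
exact: (@cvgr_dist_le _ _ _ (nbhs x) _ (G j) (G j x) (cG j x)).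
Unshelve. all: by end_near. Qed.

Lemma smooth_row (G : 'I_n -> 'rV[R]_n -> R) : (forall j, smooth (G j)) ->
  smooth (fun x => \row_j G j x : 'rV[R]_n).
Proof.
move=> + s; elim: s G => [|i s IH] G HG /=.
  split; first by apply: continuous_row => j; have [] := HG j [::].
  move=> i x; apply/derivable_mxP => k j.
  rewrite (_ : (fun _ => _) = G j); first by have [_] := HG j [::]; exact.
  by apply/funext => z; rewrite mxE.
have GE k j : (fun x => (\row_j G j x : 'rV[R]_n) k j) = G j.
  by apply/funext => z; rewrite mxE.
rewrite (_ : 'D__ _ = fun x => \row_j 'D_(evec i) (G j) x); last first.
  apply/funext => x; rewrite derive_mx.
    by apply/rowP => j; rewrite !mxE GE.
  by apply/derivable_mxP => k j; rewrite GE; have [_] := HG j [::]; exact.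
by apply: IH => j s'; exact: (HG j (i :: s')).
Qed.

Lemma bounded_compact_support (V : normedModType R) (g : 'rV[R]_n -> V) (K : set 'rV[R]_n) :
  compact K -> continuous g -> (forall x, ~ K x -> g x = 0) ->
  exists2 M : R, 0 <= M & forall x, `|g x| <= M.
Proof.
move=> cK cg gK.
have : bounded_set (g @` K).
  apply: compact_bounded; apply: continuous_compact => //.
  exact: continuous_subspaceT.
move=> [M [_ HM]]; exists (`|M| + 1); first by rewrite addr_ge0.
move=> x; have [Kx|/gK ->] := pselect (K x); last by rewrite normr0 addr_ge0.
by apply: HM; [rewrite ltr_pwDr// ler_norm|exists x].
Qed.

Lemma compactly_supported_ball (V : normedModType R) (g : 'rV[R]_n -> V) (B : R) :
  (forall x, B < `|x| -> g x = 0) -> compactly_supported g.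
Proof.
move=> gB.
have clB : closed [set x : 'rV[R]_n | `|x| <= B].
  by apply: (closed_comp (fun x _ => @norm_continuous R 'rV[R]_n x) (@closed_le R B)).
have sB : closure [set x | g x != 0] `<=` [set x : 'rV[R]_n | `|x| <= B].
  rewrite [X in _ `<=` X]((closure_id _).1 clB).
  apply: closure_subset => x /= gx; rewrite leNgt; apply/negP => /gB gx0.
  by rewrite gx0 eqxx in gx.
apply: bounded_closed_compact; last exact: closed_closure.
exists B; split; first exact: num_real.
by move=> M BM x /sB /= xB; rewrite (le_trans xB)// ltW.
Qed.

Lemma support_bounded (V : normedModType R) (g : 'rV[R]_n -> V) :
  compactly_supported g -> exists2 B : R, 0 <= B & forall x, B < `|x| -> g x = 0.
Proof.
move=> /compact_bounded[M [_ HM]]; exists (`|M| + 1); first by rewrite addr_ge0.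
move=> x Bx; apply/eqP; apply: contraTT Bx => gx; rewrite -leNgt; apply: HM.
  by rewrite ltr_pwDr// ler_norm.
exact: subset_closure.
Qed.

(** The complement of [K] is open and phi vanishes on it, so the partial derivatives vanish there
    too; being continuous, they are bounded, and the Lipschitz bound follows for each component. *)
Lemma smooth_compact_lipschitz phi : smooth phi -> compactly_supported phi ->
  exists2 L : R, 0 <= L & forall x y, `|phi x - phi y| <= L * `|x - y|.
Proof.
move=> sphi cphi; set K := closure [set x | phi x != 0] in cphi.
have /choice[M HM] : forall i, exists M : R, 0 <= M /\ forall x, `|'D_(evec i) phi x| <= M.
  move=> i; have [ci _] := sphi [:: i].
  suff H x : ~ K x -> 'D_(evec i) phi x = 0.
    by have [M M0 HM] := bounded_compact_support cphi ci H; exists M.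
  move=> Kx; rewrite -(@derive_cst R 'rV[R]_n 'rV[R]_n 0 x (evec i)).
  apply: near_eq_derive; have oK : open (~` K) by exact/closed_openC/closed_closure.
  have : nbhs x (~` K) by exact: open_nbhs_nbhs.
  apply: filterS => y Ky; apply/eqP; apply: contra_notT Ky => y0.
  exact: subset_closure.
pose S := \sum_i M i; have S0 : 0 <= S by apply: sumr_ge0 => i _; have [] := HM i.
exists (n%:R * S); first by rewrite mulr_ge0.
move=> x y; apply: normr_rV_le => [|j]; first by rewrite mulr_ge0// mulr_ge0.
rewrite !mxE; have dphi i z : derivable phi z (evec i) by have [_] := sphi [::]; exact.
apply: (@bounded_partials_lipschitz _ _ (fun x => phi x ord0 j)) => i z.
  by have /derivable_mxP := dphi i z; exact.
have -> : 'D_(evec i) (fun x => phi x ord0 j) z = ('D_(evec i) phi z) ord0 j.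
  by rewrite derive_mx// mxE.
rewrite (le_trans (ler_coord_norm _ _))// (le_trans ((HM i).2 z))//.
rewrite /S (bigD1 i)//= lerDl; apply: sumr_ge0 => k _; have [] := HM k; done.
Qed.

Lemma L1_compact_support (g : 'rV[R]_n -> R) (M B : R) : measurable_fun setT g ->
  (forall x, `|g x| <= M) -> (forall x, B < `|x| -> g x = 0) -> g \in_L1.
Proof.
move=> mg gM gB; have mB := @measurable_cball_rV R n B.
apply: (@le_integrable _ _ _ _ _ measurableT _
    (fun x => (M%:E * (\1_[set x : 'rV[R]_n | `|x| <= B] x)%:E)%E)) => //.
- exact/measurable_EFinP.
- move=> x _; rewrite /= lee_fin indicE; have [|xB] := boolP (x \in _).
    by rewrite mulr1 (le_trans (gM x))// ler_norm.
  rewrite gB ?normr0//; rewrite ltNge; apply/negP => Bx.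
  by move: xB; rewrite mem_set.
- by apply: integrableZl => //; apply: l1_indic => //; exact: lebesgue_rV_cball_lty.
Qed.

Lemma measurable_rV_continuous phi : continuous phi -> measurable_fun setT phi.
Proof.
move=> cphi; apply: measurable_fun_rV => j.
apply: continuous_measurable_rV => x.
by apply: continuous_comp; [exact: cphi|exact: coord_continuous].
Qed.

End vector_fields.

(** * Mollification *)

Section Rintegral_fubini.
Context {R : realType} {n : nat}.
Notation leb := (@lebesgue_rV R n).
Notation "f \in_L1" := (leb.-integrable [set: 'rV[R]_n] (EFin \o f)) (at level 10).
Implicit Types (F : 'rV[R]_n * 'rV[R]_n -> R) (a b : 'rV[R]_n -> R).

Lemma EFin_Rintegral a : a \in_L1 -> ((\int[leb]_x a x)%:E = \int[leb]_x (a x)%:E)%E.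
Proof. by move=> aL1; rewrite /Rintegral fineK//; exact: integrable_fin_num aL1. Qed.

Lemma measurable_integral (G : 'rV[R]_n * 'rV[R]_n -> \bar R) :
  measurable_fun setT G -> (forall p, (0 <= G p)%E) ->
  measurable_fun setT (fun x => \int[leb]_y G (x, y))%E.
Proof. by move=> mG G0; exact: (measurable_fun_fubini_tonelli_F G). Qed.

Lemma measurable_Rintegral F : measurable_fun setT F ->
  measurable_fun setT (fun x => \int[leb]_y F (x, y)).
Proof.
move=> mF; have mEF : measurable_fun setT (EFin \o F) by exact/measurable_EFinP.
rewrite /Rintegral; apply: (measurableT_comp (f := fine)) => //.
rewrite [X in measurable_fun _ X](_ : _ = fun x =>
    \int[leb]_y ((EFin \o F)^\+ (x, y)) - \int[leb]_y ((EFin \o F)^\- (x, y)))%E; last first.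
  apply/funext => x; rewrite integralE.
  by congr (_ - _)%E; apply: eq_integral => y _; rewrite ?funeposE ?funenegE.
apply: emeasurable_funB.
- by apply: measurable_integral => //; exact: measurable_funepos.
- by apply: measurable_integral => //; exact: measurable_funeneg.
Qed.

(** [Rintegral] passes through [fine], so the inner integrals have to be finite at every point
    before Fubini in the extended reals can be invoked. *)
Lemma Rintegral_Fubini F : measurable_fun setT F ->
  (forall x, (fun y => F (x, y)) \in_L1) -> (forall y, (fun x => F (x, y)) \in_L1) ->
  (\int[leb]_y \int[leb]_x `|(F (x, y))%:E| < +oo)%E ->
  \int[leb]_x \int[leb]_y F (x, y) = \int[leb]_y \int[leb]_x F (x, y).
Proof.
move=> mF F1 F2 Foo.
have mEF : measurable_fun setT (EFin \o F) by exact/measurable_EFinP.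
have iF : (leb \x leb)%E.-integrable setT (EFin \o F) by apply/integrable21ltyP.
rewrite /Rintegral; congr fine.
under eq_integral do rewrite EFin_Rintegral//.
under [RHS]eq_integral do rewrite EFin_Rintegral//.
exact: (@Fubini _ _ _ _ _ leb leb (EFin \o F)).
Qed.

(** Meant for a mollifier in one variable times the singular weight in the other. *)
Lemma Rintegral_Fubini_dominated F a b : measurable_fun setT F ->
  a \in_L1 -> b \in_L1 -> (forall x, 0 <= a x) -> (forall x, 0 <= b x) ->
  (forall x y, `|F (x, y)| <= a x * b y) ->
  \int[leb]_x \int[leb]_y F (x, y) = \int[leb]_y \int[leb]_x F (x, y).
Proof.
move=> mF aL1 bL1 a0 b0 Fab.
have ma := measurable_l1 aL1; have mb := measurable_l1 bL1.
have m1 x : measurable_fun setT (fun y => F (x, y)).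
  by apply: (measurableT_comp mF); exact: measurable_pair1.
have m2 y : measurable_fun setT (fun x => F (x, y)).
  by apply: (measurableT_comp mF); exact: measurable_pair2.
apply: Rintegral_Fubini => //.
- move=> x; apply: (@le_integrable _ _ _ _ _ measurableT _ (fun y => (a x)%:E * (b y)%:E)%E) => //.
  + exact/measurable_EFinP.
  + by move=> y _; rewrite /= lee_fin (le_trans (Fab _ _))// ler_norm.
  + exact: integrableZl.
- move=> y; apply: (@le_integrable _ _ _ _ _ measurableT _ (fun x => (b y)%:E * (a x)%:E)%E) => //.
  + exact/measurable_EFinP.
  + by move=> x _; rewrite /= lee_fin (le_trans (Fab _ _))// mulrC ler_norm.
  + exact: integrableZl.
- apply: (@le_lt_trans _ _ (\int[leb]_y ((\int[leb]_x a x)%:E * (b y)%:E))%E); last first.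
    rewrite integralZl// -EFin_Rintegral// -EFinM; exact: ltry.
  apply: ge0_le_integral => //.
  + by move=> y _; exact: integral_ge0.
  + apply: (measurable_fun_fubini_tonelli_G (fun p => `|(F p)%:E|%E)) => //.
    by apply: measurableT_comp => //; exact/measurable_EFinP.
  + by apply: measurable_funeM; exact/measurable_EFinP.
  + move=> y _; rewrite EFin_Rintegral// -integralZr//.
    apply: ge0_le_integral => //.
    * by apply: measurableT_comp => //; exact/measurable_EFinP.
    * by apply: emeasurable_funM => //; exact/measurable_EFinP.
    * by move=> x _; rewrite -EFinM lee_fin.
Qed.

Lemma Rintegral_sum (I : Type) (s : seq I) (f : I -> 'rV[R]_n -> R) :
  (forall i, (f i) \in_L1) ->
  (fun x => \sum_(i <- s) f i x) \in_L1 /\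
  \int[leb]_x (\sum_(i <- s) f i x) = \sum_(i <- s) \int[leb]_x f i x.
Proof.
move=> fL1; elim: s => [|i s [IH1 IH2]].
  under eq_fun do rewrite big_nil; split; first exact: integrable0.
  by rewrite big_nil Rintegral_cst// mul0r.
under eq_fun do rewrite big_cons; split.
  exact: L1D.
by rewrite RintegralD// IH2 big_cons.
Qed.

Lemma Rintegral_translate h a : measurable_fun setT a ->
  \int[leb]_x a (x + h) = \int[leb]_x a x.
Proof.
move=> ma; rewrite /Rintegral; congr fine.
by apply: (@integral_translate _ _ h (EFin \o a)); exact/measurable_EFinP.
Qed.

End Rintegral_fubini.

(** * L^1 estimates and self-adjointness of convolution *)

Section mollification.
Context {R : realType} {n : nat}.
Notation leb := (@lebesgue_rV R n).
Notation "f \in_L1" := (leb.-integrable [set: 'rV[R]_n] (EFin \o f)) (at level 10).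
Variables (r : R) (k : 'rV[R]_n -> R).
Hypothesis kP : mollifier r k.
Implicit Types (f g W : 'rV[R]_n -> R) (x y h : 'rV[R]_n).

Let mk := measurable_mollifier kP.
Let kL1 := mollifier_L1 kP.
Let k0 := mollifier_ge0 kP.

Lemma mollifier_sub x y : k (x - y) = k (y - x).
Proof. by rewrite -(mollifier_even kP) opprB. Qed.

Lemma mollifier_sub_L1 x : (fun y => k (x - y)) \in_L1.
Proof.
rewrite (_ : (fun y => _) = fun y => k (y - x)); first exact: l1_translate kL1.
by apply/funext => y; rewrite mollifier_sub.
Qed.

Lemma mollifier_sub_int x : \int[leb]_y k (x - y) = 1.
Proof.
rewrite -(mollifier_int kP) -(Rintegral_translate (- x) mk).
by apply: eq_Rintegral => y _; rewrite mollifier_sub.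
Qed.

Lemma conv_translateE f x : measurable_fun setT f ->
  conv f k x = \int[leb]_h (f (x + h) * k h).
Proof.
move=> mf; rewrite /conv -(Rintegral_translate x); last first.
  apply: measurable_funM => //; apply: (measurableT_comp mk); exact: measurable_subl.
by apply: eq_Rintegral => h _; rewrite opprD addrCA subrr addr0 (mollifier_even kP) addrC.
Qed.

Lemma smooth_continuous f : smooth f -> continuous f.
Proof. by move=> /(_ [::])[]. Qed.

Lemma measurable_conv f : f \in_L1 -> measurable_fun setT (conv f k).
Proof.
by move=> fL1; apply: continuous_measurable_rV; apply: smooth_continuous; exact: mollifier_smooth kP _ fL1.
Qed.

(** Since [k] is an even probability density, conv f k - f is the average over h, with weight k(h),
    of the increments f(. + h) - f. Tonelli moves the L^1 norm inside, and only |h| <= r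
    contributes. *)
Lemma l1dist_conv f (e : \bar R) : f \in_L1 ->
  (forall h, (`|h| <= r)%R -> l1dist (translate h f) f <= e)%E ->
  (l1dist (conv f k) f <= e)%E.
Proof.
move=> fL1 He; have mf := measurable_l1 fL1.
have [C HC] := mollifier_bounded kP.
(* For r >= 0 take h = 0 in [He]; a negative radius would force k = 0, against its integral being
   1. *)
have e0 : (0 <= e)%E.
  have [r0|r0] := leP 0 r.
    by rewrite (le_trans _ (He 0 _)) ?normr0//; apply: integral_ge0 => x _; rewrite lee_fin.
  have := mollifier_int kP.
  rewrite (_ : k = fun=> 0); last first.
    apply/funext => x; apply: (mollifier_out kP); exact: le_trans (ltW r0) (normr_ge0 x).
  by rewrite Rintegral_cst// mul0r => /eqP; rewrite eq_sym oner_eq0.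
pose G (p : 'rV[R]_n * 'rV[R]_n) : \bar R := (`|f (p.1 + p.2) - f p.1| * k p.2)%:E.
have mG : measurable_fun setT G.
  apply/measurable_EFinP; apply: measurable_funM; last exact: (measurableT_comp mk).
  apply: measurableT_comp => //; apply: measurable_funB.
    by apply: (measurableT_comp mf); apply: measurable_rVD.
  exact: (measurableT_comp mf).
have G0 p : (0 <= G p)%E by rewrite lee_fin mulr_ge0.
apply: (@le_trans _ _ (\int[leb]_x \int[leb]_h G (x, h))%E).
  apply: ge0_le_integral => //.
  - by apply: measurable_l1dist => //; exact: measurable_conv.
  - exact: (measurable_fun_fubini_tonelli_F G).
  move=> x _.
  have i1 : (fun h => f (x + h) * k h) \in_L1.
    apply: (@integrableM_bounded _ _ _ _ C) => //.
    rewrite (_ : (fun h => f (x + h)) = translate x f); first exact: l1_translate.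
    by apply/funext => h; rewrite /translate addrC.
  have i2 : (fun h => f x * k h) \in_L1.
    exact: L1Zl.
  have -> : conv f k x - f x = \int[leb]_h ((f (x + h) - f x) * k h).
    rewrite (conv_translateE _ mf) -[X in _ - X]mulr1 -(mollifier_int kP) -RintegralZl//.
    by rewrite -RintegralB//; apply: eq_Rintegral => h _; rewrite mulrBl.
  have i3 : (fun h => (f (x + h) - f x) * k h) \in_L1.
    by under eq_fun do rewrite mulrBl; exact: L1B.
  rewrite EFin_normr_Rintegral// (le_trans (le_abse_integral _ _ _))//.
    exact: measurable_int i3.
  apply: ge0_le_integral => //.
  - by apply: measurableT_comp => //; exact: measurable_int i3.
  - by apply: (measurableT_comp mG); exact: measurable_pair1.
  - by move=> h _; rewrite /G/= lee_fin normrM (ger0_norm (k0 h)).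
rewrite (fubini_tonelli (m1 := leb) (m2 := leb) G)//.
apply: (@le_trans _ _ (\int[leb]_h ((k h)%:E * e))%E).
  apply: ge0_le_integral => //.
  - by move=> h _; apply: integral_ge0 => x _; exact: G0.
  - exact: (measurable_fun_fubini_tonelli_G G).
  - by apply: emeasurable_funM => //; exact/measurable_EFinP.
  move=> h _; rewrite /G/=; under eq_integral do rewrite mulrC EFinM.
  rewrite ge0_integralZl_EFin//; last first.
    by apply: measurable_l1dist => //; exact: measurable_fun_translate.
  have [hr|hr] := leP `|h| r; first by rewrite lee_wpmul2l ?lee_fin// He.
  by rewrite (mollifier_out kP (ltW hr)) !mul0e.
rewrite ge0_integralZr//; last 2 first.
- exact/measurable_EFinP.
- by move=> h _; rewrite lee_fin.
by rewrite -EFin_Rintegral// (mollifier_int kP) mul1e.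
Qed.

(** Twice the L^1 norm of [f] bounds the distance from [f] to each of its translates, so
    [l1dist_conv] puts conv f k - f in L^1. *)
Lemma conv_L1 f : f \in_L1 -> (conv f k) \in_L1.
Proof.
move=> fL1; have mf := measurable_l1 fL1; have mc := measurable_conv fL1.
have [_ foo] := integrableP _ _ _ fL1.
have H h : (l1dist (translate h f) f <= \int[leb]_x `|(f x)%:E| + \int[leb]_x `|(f x)%:E|)%E.
  have mfh := measurable_fun_translate h mf.
  have mEf : measurable_fun setT (fun x => `|(f x)%:E|%E).
    by apply: measurableT_comp => //; exact/measurable_EFinP.
  have mEfh : measurable_fun setT (fun x => `|(translate h f x)%:E|%E).
    by apply: measurableT_comp => //; exact/measurable_EFinP.
  rewrite -{1}(ge0_integral_translate h mEf)// -ge0_integralD//.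
  apply: ge0_le_integral => //.
  - exact: measurable_l1dist.
  - exact: emeasurable_funD.
  - by move=> x _; rewrite -EFinD lee_fin ler_normB.
have dL1 : (conv f k \- f) \in_L1.
  apply/integrableP; split; first by apply/measurable_EFinP; exact: measurable_funB.
  have := l1dist_conv fL1 (fun h _ => H h); rewrite /l1dist => /le_lt_trans; apply.
  by rewrite lte_add_pinfty.
by have := L1D dL1 fL1; under eq_fun do rewrite /= subrK.
Qed.

(** Fubini, with evenness of [k] exchanging the roles of x and y. [W] will be a fractional
    divergence, known to be bounded; absolute convergence comes from [f] and the unit mass of
    [k]. *)
Lemma conv_adjoint f W (C : R) : f \in_L1 -> measurable_fun setT W ->
  (forall x, `|W x| <= C) ->
  \int[leb]_x (conv f k x * W x) = \int[leb]_y (f y * conv W k y).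
Proof.
move=> fL1 mW WC; have [D HD] := mollifier_bounded kP.
have mf := measurable_l1 fL1.
pose F (p : 'rV[R]_n * 'rV[R]_n) := f p.2 * k (p.1 - p.2) * W p.1.
have mF : measurable_fun setT F.
  apply: measurable_funM; last exact: (measurableT_comp mW).
  apply: measurable_funM; first exact: (measurableT_comp mf).
  by apply: (measurableT_comp mk); apply: measurable_rVB.
have L1y x : (fun y => f y * k (x - y)) \in_L1 by exact: conv_integrable HD.
have L1x y : (fun x => k (x - y) * W x) \in_L1.
  apply: (@integrableM_bounded _ _ _ _ C) => //.
  by have := mollifier_sub_L1 y; under eq_fun do rewrite mollifier_sub.
have F1 x : (fun y => F (x, y)) \in_L1.
  exact: (L1Zr (W x) (L1y x)).
have F2 y : (fun x => F (x, y)) \in_L1.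
  by rewrite /F /=; under eq_fun do rewrite -mulrA; exact: L1Zl.
transitivity (\int[leb]_x \int[leb]_y F (x, y)).
  apply: eq_Rintegral => x _; rewrite /conv mulrC -RintegralZl//.
  by apply: eq_Rintegral => y _; rewrite mulrC.
rewrite Rintegral_Fubini//.
  apply: eq_Rintegral => y _.
  have WE : conv W k y = \int[leb]_x (k (x - y) * W x).
    by apply: eq_Rintegral => x _; rewrite mulrC mollifier_sub.
  by rewrite WE -RintegralZl//; apply: eq_Rintegral => x _; rewrite mulrA.
apply: (@le_lt_trans _ _ (\int[leb]_y (C%:E * `|(f y)%:E|))%E); last first.
  rewrite integralZl//; last exact: integrable_abse.
  have [_ foo] := integrableP _ _ _ fL1.
  have : (\int[leb]_x `|(f x)%:E| \is a fin_num)%E by rewrite ge0_fin_numE// integral_ge0.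
  by move=> /fineK <-; rewrite -EFinM ltry.
have C0 : 0 <= C by rewrite (le_trans _ (WC 0)).
apply: ge0_le_integral => //.
- by move=> y _; exact: integral_ge0.
- apply: (measurable_fun_fubini_tonelli_G (fun p => `|(F p)%:E|%E)) => //.
  by apply: measurableT_comp => //; exact/measurable_EFinP.
- by apply: measurable_funeM; apply: measurableT_comp => //; exact/measurable_EFinP.
move=> y _.
apply: (@le_trans _ _ (\int[leb]_x ((C * `|f y|)%:E * (k (y - x))%:E))%E).
  apply: ge0_le_integral => //.
  - by apply: measurableT_comp => //; exact: measurable_int (F2 y).
  - by apply: measurable_funeM; exact: measurable_int (mollifier_sub_L1 y).
  move=> x _; rewrite -EFinM lee_fin /F/= !normrM mollifier_sub (ger0_norm (k0 _)).
  by rewrite mulrC mulrA ler_wpM2r// ler_wpM2r.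
by rewrite integralZl ?mollifier_sub_L1// -EFin_Rintegral ?mollifier_sub_L1// mollifier_sub_int mule1 EFinM.
Qed.

End mollification.

(** * Fractional divergence and convolution *)

Section fractional_divergence.
Context {R : realType} {n : nat}.
Notation leb := (@lebesgue_rV R n).
Notation "f \in_L1" := (leb.-integrable [set: 'rV[R]_n] (EFin \o f)) (at level 10).
Variable alpha : R.
Hypotheses (n_gt0 : (0 < n)%N) (alpha01 : 0 < alpha < 1).
Implicit Types (x y h : 'rV[R]_n) (phi : 'rV[R]_n -> 'rV[R]_n).

(** The integrand of [fdiv] after y = x + h, which fixes the singularity at h = 0 for all x. *)
Definition fquot phi x h : R :=
  edot h (phi (x + h) - phi x) / enorm h `^ (n%:R + alpha + 1).

(** The Lipschitz bound controls the integrand for small h, the sup bound for large h. *)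
Record bounded_lipschitz phi : Prop := BoundedLipschitz {
  bl_measurable : measurable_fun setT phi;
  bl_bounded : exists2 M : R, 0 <= M & forall x, `|phi x| <= M;
  bl_lipschitz : exists2 L : R, 0 <= L & forall x y, `|phi x - phi y| <= L * `|x - y| }.

Lemma measurable_fquot phi : measurable_fun setT phi ->
  measurable_fun setT (fun p : 'rV[R]_n * 'rV[R]_n => fquot phi p.1 p.2).
Proof.
move=> mphi; rewrite /fquot; under eq_fun do rewrite -powRN.
apply: measurable_funM.
  apply: measurable_edot => //; apply: measurable_rVB.
    by apply: (measurableT_comp mphi); apply: measurable_rVD.
  exact: (measurableT_comp mphi).
by apply: (measurableT_comp (measurable_powR _)); exact: measurable_enorm.
Qed.

Lemma fquot_bound phi : bounded_lipschitz phi -> exists2 C : R, 0 <= C &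
  forall x h, `|fquot phi x h| <= C * frac_weight alpha h.
Proof.
move=> [_ [M M0 HM] [L L0 HL]].
(* n compares the scalar product with sup norms; L serves for |h| <= 1 and 2 M for |h| > 1. *)
exists (n%:R * (L + 2 * M)); first by rewrite mulr_ge0// addr_ge0// mulr_ge0.
move=> x h; have [h0|h0] := eqVneq h 0.
  rewrite /fquot h0 (_ : edot 0 _ = 0) ?mul0r ?normr0.
    by rewrite !mulr_ge0 ?addr_ge0 ?mulr_ge0 ?frac_weight_ge0.
  by rewrite /edot big1// => i _; rewrite mxE mul0r.
have hp : 0 < `|h| by rewrite normr_gt0.
have ep : 0 < enorm h by rewrite (lt_le_trans hp)// ler_norm_enorm.
set v := phi (x + h) - phi x.
have vmin : `|v| <= (L + 2 * M) * Num.min `|h| 1.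
  have [h1|h1] := leP `|h| 1.
    rewrite (le_trans (HL _ _))// addrAC subrr add0r ler_wpM2r// lerDl mulr_ge0//.
  rewrite mulr1 (le_trans (ler_normB _ _))// mulr_natl mulr2n.
  by rewrite (le_trans (lerD (HM _) (HM _)))// lerDr.
rewrite /fquot -/v normrM normfV (ger0_norm (powR_ge0 _ _)).
rewrite ler_pdivrMr ?powR_gt0//.
rewrite (le_trans (ler_norm_edot _ _))//.
rewrite /frac_weight -!mulrA ler_wpM2l//.
(* Passing from the Euclidean to the smaller sup norm in the denominator only enlarges the quotient;
   the extra power of |h| cancels the one from the scalar product. *)
have hs : `|h| `^ (n%:R + alpha) * `|h| <= enorm h `^ (n%:R + alpha + 1).
  rewrite -[X in _ * X <= _]powRr1 ?normr_ge0// -powRD; last by rewrite normr_eq0 h0 implybT.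
  have s0 : 0 <= n%:R + alpha + 1 by case/andP: alpha01 => a0 _; rewrite !addr_ge0// ltW.
  by rewrite ge0_ler_powR ?nnegrE ?enorm_ge0// ler_norm_enorm.
have hpp : 0 < `|h| `^ (n%:R + alpha) by rewrite powR_gt0.
have m0 : 0 <= (L + 2 * M) * Num.min `|h| 1.
  by rewrite (le_trans _ vmin).
apply: (@le_trans _ _ ((L + 2 * M) * (Num.min `|h| 1 *
    (((`|h| `^ (n%:R + alpha))^-1) * (`|h| `^ (n%:R + alpha) * `|h|))))); last first.
  rewrite ler_wpM2l ?addr_ge0 ?mulr_ge0//.
  by rewrite ler_wpM2l ?le_min ?normr_ge0 ?ler01// ler_wpM2l// invr_ge0 (ltW hpp).
by rewrite mulKf ?gt_eqF// mulrA [leLHS]mulrC ler_wpM2r.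
Qed.

Let wL1 := integrable_frac_weight n_gt0 alpha01.

Lemma fquot_L1 phi x : bounded_lipschitz phi -> (fquot phi x) \in_L1.
Proof.
move=> bl; have [C C0 HC] := fquot_bound bl.
have mq := measurable_fquot (bl_measurable bl).
apply: (@le_integrable _ _ _ _ _ measurableT _
   (EFin \o (fun h => C * frac_weight alpha h))) => //.
- apply/measurable_EFinP; exact: (measurableT_comp mq (measurable_pair1 x)).
- by move=> h _; rewrite /= lee_fin (le_trans (HC _ _))// ler_norm.
- exact: L1Zl.
Qed.

Lemma fdivE phi x : bounded_lipschitz phi ->
  fdiv alpha phi x = mu_const n alpha * \int[leb]_h fquot phi x h.
Proof.
move=> bl; have mq := measurable_l1 (fquot_L1 x bl).
have E : \int[leb]_y (edot (y - x) (phi y - phi x) / enorm (y - x) `^ (n%:R + alpha + 1)) =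
    \int[leb]_h fquot phi x h.
  rewrite -(Rintegral_translate (- x) mq); apply: eq_Rintegral => y _.
  by rewrite /fquot addrCA subrr addr0.
by rewrite /fdiv E.
Qed.

Lemma measurable_fdiv phi : bounded_lipschitz phi -> measurable_fun setT (fdiv alpha phi).
Proof.
move=> bl; rewrite (_ : fdiv _ _ = fun x => mu_const n alpha * \int[leb]_h fquot phi x h).
  apply: measurable_funM => //.
  exact: measurable_Rintegral (measurable_fquot (bl_measurable bl)).
by apply/funext => x; rewrite fdivE.
Qed.

Lemma fdiv_bounded phi : bounded_lipschitz phi ->
  exists2 C : R, 0 <= C & forall x, `|fdiv alpha phi x| <= C.
Proof.
move=> bl; have [C C0 HC] := fquot_bound bl.
exists (`|mu_const n alpha| * (C * \int[leb]_h frac_weight alpha h)).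
  by rewrite mulr_ge0// mulr_ge0// Rintegral_ge0// => h _; exact: frac_weight_ge0.
move=> x; rewrite fdivE// normrM ler_wpM2l//.
rewrite (le_trans (le_normr_Rintegral _ (fquot_L1 x bl)))//.
rewrite -RintegralZl//; apply: le_Rintegral => //.
- by apply: integrable_norm; exact: fquot_L1.
- exact: L1Zl.
Qed.

Section mollified.
Variables (r : R) (k : 'rV[R]_n -> R).
Hypothesis kP : mollifier r k.
Let mk := measurable_mollifier kP.
Let kL1 := mollifier_L1 kP.
Let k0 := mollifier_ge0 kP.

Definition conv_field phi x : 'rV[R]_n := \row_j conv (fun y => phi y ord0 j) k x.

Lemma edot_mollifier_L1 phi v x : bounded_lipschitz phi ->
  (fun y => edot v (phi y) * k (x - y)) \in_L1.
Proof.
move=> [mphi [M M0 HM] _]; under eq_fun do rewrite mulrC.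
apply: (@integrableM_bounded _ _ _ _ (n%:R * (`|v| * M))) => //.
- exact: mollifier_sub_L1 kP x.
- exact: measurable_edot.
- by move=> y; rewrite (le_trans (ler_norm_edot _ _))// ler_wpM2l// ler_wpM2l.
Qed.

Lemma edot_conv_field phi v x : bounded_lipschitz phi ->
  edot v (conv_field phi x) = \int[leb]_y (edot v (phi y) * k (x - y)).
Proof.
move=> [mphi [M M0 HM] _].
pose f j y := v ord0 j * (phi y ord0 j * k (x - y)).
have jL1 j : (fun y => phi y ord0 j * k (x - y)) \in_L1.
  under eq_fun do rewrite mulrC.
  apply: (@integrableM_bounded _ _ _ _ M) => //; first exact: mollifier_sub_L1 kP x.
  - exact: (measurableT_comp (measurable_coord_rV j) mphi).
  - by move=> y; rewrite (le_trans (ler_coord_norm _ _)).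
have fL1 j : (f j) \in_L1 by exact: L1Zl.
transitivity (\int[leb]_y (\sum_(j <- index_enum 'I_n) f j y)).
  rewrite (Rintegral_sum _ fL1).2; apply: eq_bigr => j _.
  by rewrite /f RintegralZl// !mxE.
apply: eq_Rintegral => y _; rewrite /edot mulr_suml; apply: eq_bigr => j _.
by rewrite /f mulrA.
Qed.

(** Shifting the integration variable by h moves the increment from the mollifier to phi. *)
Lemma conv_field_increment phi x h : bounded_lipschitz phi ->
  edot h (conv_field phi (x + h) - conv_field phi x) =
  \int[leb]_y (edot h (phi (y + h) - phi y) * k (x - y)).
Proof.
move=> bl; have i1 := edot_mollifier_L1 h (x + h) bl.
have i2 := edot_mollifier_L1 h x bl.
have i3 := l1_translate h i1.
rewrite edotBr !edot_conv_field// -(Rintegral_translate h (measurable_l1 i1)).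
rewrite -RintegralB//; apply: eq_Rintegral => y _.
by rewrite opprD addrACA subrr addr0 edotBr mulrBl.
Qed.

(** Both sides integrate k(x - y) times the quotient of phi at (y, h), in opposite orders. The
    majorant of the quotient does not depend on y, so the integrand is dominated by a product and
    Fubini applies. *)
Lemma fdiv_conv_field phi x : bounded_lipschitz phi -> bounded_lipschitz (conv_field phi) ->
  fdiv alpha (conv_field phi) x = conv (fdiv alpha phi) k x.
Proof.
move=> bl blc; have [C C0 HC] := fquot_bound bl.
pose F (p : 'rV[R]_n * 'rV[R]_n) := k (x - p.1) * (mu_const n alpha * fquot phi p.1 p.2).
have mF : measurable_fun setT F.
  apply: measurable_funM.
    by apply: (measurableT_comp mk); exact: measurable_rVB.
  by apply: measurable_funM => //; exact: measurable_fquot (bl_measurable bl).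
have kx : (fun y => k (x - y)) \in_L1 by exact: mollifier_sub_L1 kP x.
transitivity (\int[leb]_y \int[leb]_h F (y, h)); last first.
  apply: eq_Rintegral => y _; have q1 := fquot_L1 y bl.
  have q2 := L1Zl (mu_const n alpha) q1.
  by rewrite fdivE// [RHS]mulrC -!RintegralZl.
rewrite (@Rintegral_Fubini_dominated _ _ F (fun y => k (x - y))
    (fun h => `|mu_const n alpha| * C * frac_weight alpha h)) //; first last.
- move=> y h; rewrite /F/= (normrM (k _)) (normrM (mu_const _ _)) (ger0_norm (k0 _)).
  by rewrite ler_wpM2l// -mulrA ler_wpM2l.
- by move=> h; rewrite mulr_ge0 ?mulr_ge0// frac_weight_ge0.
- exact: L1Zl.
rewrite fdivE// -RintegralZl//; last exact: fquot_L1.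
apply: eq_Rintegral => h _; rewrite /fquot conv_field_increment// /F/=.
have iL1 : (fun y => edot h (phi (y + h) - phi y) * k (x - y)) \in_L1.
  have := L1B (l1_translate h (edot_mollifier_L1 h (x + h) bl)) (edot_mollifier_L1 h x bl).
  rewrite /translate; under eq_fun do rewrite opprD addrACA subrr addr0 -mulrBl -edotBr.
  by [].
rewrite /fquot; move: (mu_const n alpha) (enorm h `^ _) => m q.
rewrite -(RintegralZr q^-1 measurableT iL1) -(RintegralZl m measurableT (L1Zr q^-1 iL1)).
by apply: eq_Rintegral => y _; rewrite [RHS]mulrC mulrAC !mulrA.
Qed.

End mollified.

End fractional_divergence.

(** * Fractional variation and convolution *)

Section approximation.
Context {R : realType} {n : nat}.
Notation leb := (@lebesgue_rV R n).
Notation "f \in_L1" := (leb.-integrable [set: 'rV[R]_n] (EFin \o f)) (at level 10).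
Variable alpha : R.
Hypotheses (n_gt0 : (0 < n)%N) (alpha01 : 0 < alpha < 1).
Implicit Types (x y h : 'rV[R]_n) (phi : 'rV[R]_n -> 'rV[R]_n) (f g : 'rV[R]_n -> R).

Lemma test_field_bl phi : test_field phi -> bounded_lipschitz phi.
Proof.
move=> [sphi cphi _]; have cont : continuous phi by have [] := sphi [::].
split.
- exact: measurable_rV_continuous.
- apply: bounded_compact_support cphi cont _ => x nx.
  apply/eqP; apply: contra_notT nx => ?; exact: subset_closure.
- exact: smooth_compact_lipschitz.
Qed.

Lemma test_field_ae phi : test_field phi -> {ae leb, forall x, enorm (phi x) <= 1}.
Proof.
move=> [_ _]; rewrite unlock /Lnorm lebesgue_rV_setT_gt0 => /ess_supP.
by apply: filterS => x /=; rewrite lee_fin; apply: le_trans; exact: ler_norm.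
Qed.

Lemma Lnorm_enorm_le1 phi : (forall x, enorm (phi x) <= 1) ->
  ('N[leb]_+oo[EFin \o (enorm (n:=n) \o phi)] <= 1)%E.
Proof.
move=> H; rewrite unlock /Lnorm lebesgue_rV_setT_gt0; apply/ess_supP/aeW => x /=.
by rewrite lee_fin ger0_norm ?enorm_ge0.
Qed.

(** Testing with the zero field keeps [fvar] away from -oo. *)
Lemma test_field0 : test_field (fun _ : 'rV[R]_n => 0 : 'rV[R]_n).
Proof.
split.
- move=> s; elim: s => [|i s IH] /=.
    by split => [|i x]; [exact: cst_continuous|exact: derivable_cst].
  rewrite (_ : 'D__ _ = fun _ => 0)//.
  by apply/funext => x; exact: derive_cst.
- by apply: (@compactly_supported_ball _ _ _ _ 0).
- apply: Lnorm_enorm_le1 => x; rewrite /enorm /edot big1 ?sqrtr0//.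
  by move=> i _; rewrite mxE mul0r.
Qed.

Lemma integral_mul_fdiv f phi : f \in_L1 -> bounded_lipschitz phi ->
  (fun x => f x * fdiv alpha phi x) \in_L1 /\
  (\int[leb]_x (f x * fdiv alpha phi x)%:E =
   (\int[leb]_x (f x * fdiv alpha phi x))%R%:E)%E.
Proof.
move=> fL1 bl; have [C C0 HC] := fdiv_bounded n_gt0 alpha01 bl.
have L : (fun x => f x * fdiv alpha phi x) \in_L1.
  by apply: integrableM_bounded HC => //; exact: measurable_fdiv.
by split => //; rewrite EFin_Rintegral.
Qed.

Lemma le_fvar f phi : test_field phi ->
  (\int[leb]_x (f x * fdiv alpha phi x)%:E <= fvar alpha f)%E.
Proof. by move=> tphi; apply: ereal_sup_ubound; exists phi. Qed.

Section mollified_variation.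
Variables (r : R) (k : 'rV[R]_n -> R).
Hypothesis kP : mollifier r k.

(* Pairing v = (phi * k)(x) with itself gives |v|^2 <= |v|, because |phi| <= 1 only a.e. and
   k is a probability density. *)
Lemma conv_field_le1 phi x : test_field phi -> enorm (conv_field k phi x) <= 1.
Proof.
move=> tphi; have bl := test_field_bl tphi.
set v := conv_field k phi x.
have vL1 := edot_mollifier_L1 kP v x bl.
have kx := mollifier_sub_L1 kP x.
have vv : edot v v <= enorm v.
  rewrite {2}/v (edot_conv_field kP)// -lee_fin.
  have -> : (enorm v)%:E = (\int[leb]_y (enorm v * k (x - y))%:E)%E.
    rewrite -EFin_Rintegral; last exact: L1Zl.
    by rewrite RintegralZl// (mollifier_sub_int kP) mulr1.
  rewrite (le_trans (y := (`|\int[leb]_y (edot v (phi y) * k (x - y))|)%:E))//.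
    by rewrite lee_fin ler_norm.
  rewrite EFin_normr_Rintegral// (le_trans (le_abse_integral _ _ _))//.
    exact: measurable_int vL1.
  apply: ae_ge0_le_integral => //.
  - by apply: measurableT_comp => //; exact: measurable_int vL1.
  - by move=> y _; rewrite lee_fin mulr_ge0 ?enorm_ge0// (mollifier_ge0 kP).
  - by apply: (measurable_int leb); exact: L1Zl.
  have := test_field_ae tphi; apply: filterS => y phi1 _.
  rewrite lee_fin normrM (ger0_norm (mollifier_ge0 kP _)) ler_wpM2r ?(mollifier_ge0 kP)//.
  (* Cauchy-Schwarz is stated one-sidedly; using it for v and -v bounds the absolute value. *)
  have := edot_le_enorm v (phi y); have := edot_le_enorm (- v) (phi y).
  have eN : enorm (- v) = enorm v.
    by rewrite /enorm /edot; congr Num.sqrt; apply: eq_bigr => i _; rewrite !mxE mulrNN.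
  rewrite eN edotC -scaleN1r edotZr mulN1r edotC => h1 h2.
  have h3 : enorm v * enorm (phi y) <= enorm v by rewrite ler_piMr ?enorm_ge0.
  by rewrite ler_norml; apply/andP; split; [rewrite lerNl|]; exact: le_trans h3.
rewrite leNgt; apply/negP => v1; move: vv; apply/negP; rewrite -ltNge.
have -> : edot v v = enorm v ^+ 2 by rewrite sqr_sqrtr ?edot_ge0.
by rewrite expr2 ltr_pMr// (lt_trans ltr01).
Qed.

Lemma test_field_conv phi : test_field phi -> test_field (conv_field k phi).
Proof.
move=> tphi; have bl := test_field_bl tphi; have [sphi cphi _] := tphi.
have [B B0 HB] := support_bounded cphi.
have [mphi [M M0 HM] _] := bl.
split; last by apply: Lnorm_enorm_le1 => x; exact: conv_field_le1.
- apply: smooth_row => j; apply: (mollifier_smooth kP).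
  apply: (@L1_compact_support _ _ _ M B).
  + exact: (measurableT_comp (measurable_coord_rV j) mphi).
  + by move=> x; rewrite (le_trans (ler_coord_norm _ _)).
  + by move=> x /HB ->; rewrite mxE.
(* Convolution enlarges the support by at most the radius r of the mollifier. *)
- apply: (@compactly_supported_ball _ _ _ _ (B + r)) => x Bx.
  apply/rowP => j; rewrite !mxE /conv.
  rewrite (_ : (fun y => _) = fun _ => 0); first by rewrite Rintegral_cst// mul0r.
  apply/funext => y; have [/HB ->|yB] := ltP B `|y|; first by rewrite mxE mul0r.
  rewrite (mollifier_out kP) ?mulr0//.
  by rewrite (le_trans _ (lerB_dist _ _))// lerBrDr (le_trans _ (ltW Bx))// addrC lerD2r.
Qed.

Lemma fvar_conv_le f : f \in_L1 -> (fvar alpha (conv f k) <= fvar alpha f)%E.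
Proof.
move=> fL1; apply: ge_ereal_sup => _ [phi tphi <-].
have bl := test_field_bl tphi; have tc := test_field_conv tphi.
have blc := test_field_bl tc.
have [C C0 HC] := fdiv_bounded n_gt0 alpha01 bl.
apply: le_trans (le_fvar f tc).
rewrite (integral_mul_fdiv (conv_L1 kP fL1) bl).2 (integral_mul_fdiv fL1 blc).2 lee_fin.
rewrite (conv_adjoint kP fL1 (measurable_fdiv n_gt0 alpha01 bl) HC).
rewrite le_eqVlt; apply/orP; left; apply/eqP; apply: eq_Rintegral => y _.
by rewrite (fdiv_conv_field n_gt0 alpha01 kP).
Qed.

End mollified_variation.

(* Lower semicontinuity of the fractional variation in L^1, in quantitative form. *)
Lemma integral_fdiv_near f phi : f \in_L1 -> test_field phi ->
  exists2 C : R, 0 <= C & forall g (e : R), g \in_L1 -> (l1dist g f <= e%:E)%E ->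
    (\int[leb]_x (f x * fdiv alpha phi x)%:E - (C * e)%:E <= fvar alpha g)%E.
Proof.
move=> fL1 tphi; have bl := test_field_bl tphi.
have [C C0 HC] := fdiv_bounded n_gt0 alpha01 bl.
exists C => // g e gL1 ge; apply: le_trans (le_fvar g tphi).
have [i1 E1] := integral_mul_fdiv fL1 bl; have [i2 E2] := integral_mul_fdiv gL1 bl.
rewrite E1 E2 -EFinB lee_fin lerBlDr -lerBlDl.
rewrite -RintegralB//.
have mg := measurable_l1 gL1; have mf := measurable_l1 fL1.
have dL1 := L1B gL1 fL1.
rewrite (le_trans (ler_norm _))// (le_trans (le_normr_Rintegral _ (L1B i1 i2)))//.
have nL1 := integrable_norm dL1.
apply: (@le_trans _ _ (\int[leb]_x (C * `|g x - f x|))).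
  apply: le_Rintegral => //.
  - exact: integrable_norm (L1B i1 i2).
  - exact: L1Zl.
  - by move=> x _; rewrite -mulrBl normrM mulrC distrC ler_wpM2r.
rewrite RintegralZl// ler_wpM2l// -lee_fin EFin_Rintegral//.
Qed.

End approximation.

(** * The approximating sequence *)

Unset Implicit Arguments.

Theorem theorem3p7 (R : realType) (n : nat) (alpha : R) (f : 'rV[R]_n -> R) :
  (1 <= n)%N -> 0 < alpha < 1 -> BV alpha f ->
  exists fk : nat -> 'rV[R]_n -> R,
    [/\ forall k, BV alpha (fk k) /\ smooth (fk k),
        ('N[lebesgue_rV n]_1[EFin \o (fk k \- f)%R])%E @[k --> \oo] --> 0%E &
        fvar alpha (fk k) @[k --> \oo] --> fvar alpha f].
Proof.
move=> n1 alpha01 [fL1 foo].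
have fc := L1_translation_continuousP fL1.
have /choice[fk fkP] : forall k : nat, exists g : 'rV[R]_n -> R,
    [/\ (lebesgue_rV n).-integrable setT (EFin \o g), smooth g,
        (l1dist g f <= (k.+1%:R^-1)%:E)%E & (fvar alpha g <= fvar alpha f)%E].
  (* The mollifier radius is the modulus of continuity of translations of [f] at precision 1 / (k +
     1). *)
  move=> k; have [|d d0 Hd] := fc k.+1%:R^-1; first by rewrite invr_gt0.
  have [K KP] := @exists_mollifier R n d d0.
  exists (conv f K); split.
  - exact: conv_L1 KP _ fL1.
  - exact: (mollifier_smooth KP).
  - exact: l1dist_conv KP _ _ fL1 Hd.
  - exact: fvar_conv_le KP _ fL1.
exists fk; split.
- move=> k; have [kL1 ks kd kv] := fkP k; split => //; split => //.
  exact: le_lt_trans kv foo.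
- under eq_fun do rewrite Lnorm1.
  have cvgV : ((k.+1%:R^-1 : R)%:E @[k --> \oo] --> 0)%E.
    by apply: cvg_EFin; [exact: nearW|exact: cvg_harmonic].
  apply: squeeze_cvge (cvg_cst _) cvgV; apply: nearW => k.
  by rewrite integral_ge0//=; have [_ _ + _] := fkP k.
(* All variations involved are finite, so the convergence can be checked on real numbers. *)
- have fin g : (lebesgue_rV n).-integrable setT (EFin \o g) ->
      (fvar alpha g <= fvar alpha f)%E -> fvar alpha g \is a fin_num.
    move=> gL1 gf; apply: fin_real; rewrite (le_lt_trans gf foo) andbT.
    apply: lt_le_trans (le_fvar alpha g (@test_field0 R n)).
    by rewrite (integral_mul_fdiv n1 alpha01 gL1 (test_field_bl (@test_field0 R n))).2 ltNyr.
  have finf : fvar alpha f \is a fin_num by exact: fin.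
  have fink k : fvar alpha (fk k) \is a fin_num by have [kL1 _ _] := fkP k; exact: fin.
  rewrite -(fineK finf); apply: cvg_EFin; first exact: nearW.
  apply/cvgrPdist_le => e e0 /=.
  have e2 : 0 < e / 2 by rewrite divr_gt0.
  (* A field within e / 2 of the supremum for [f]; lower semicontinuity along it costs at most
     another e / 2, once k is large. *)
  have [_ [phi tphi <-] phie] := ub_ereal_sup_adherent e2 finf.
  have [C C0 HC] := integral_fdiv_near n1 alpha01 fL1 tphi.
  (* This threshold on 1 / (k + 1) makes C / (k + 1) <= e / 2; the added 1 covers C = 0. *)
  have q0 : 0 < e / 2 / (C + 1) by rewrite divr_gt0// ltr_pwDr.
  near=> k; have [kL1 _ kd kv] := fkP k; have ke := HC _ _ kL1 kd.
  have Ck : C * k.+1%:R^-1 <= e / 2.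
    have kq : k.+1%:R^-1 < e / 2 / (C + 1) by near: k; exact: (near_infty_natSinv_lt (PosNum q0)).
    rewrite (le_trans (ler_wpM2l C0 (ltW kq)))// mulrA ler_pdivrMr ?ltr_pwDr//.
    by rewrite mulrC ler_wpM2l ?(ltW e2)// lerDl.
  move: phie ke kv; rewrite (integral_mul_fdiv n1 alpha01 fL1 (test_field_bl tphi)).2.
  rewrite -/(fvar alpha f) -(fineK finf) -(fineK (fink k)) -!EFinB lte_fin !lee_fin /=.
  move: (Rintegral _ _ _) (fine _) (fine _) (C / _) Ck => I F Fk Q Ck h1 h2 h3.
  rewrite ger0_norm ?subr_ge0//; clear -Ck h1 h2 h3; lra.
Unshelve. all: by end_near.
Qed.
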